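(* Let $\mathfrak g$ be a locally reductive finitary Lie algebra and $\mathfrak b\subset\mathfrak g$ a Borel subalgebra. Then $\mathfrak b\cap[\mathfrak g,\mathfrak g]$ is a Borel subalgebra of $[\mathfrak g,\mathfrak g]$.
   Context: Ground field $\mathbb C$; Lie algebras of at most countable dimension. Finitary Lie algebra: locally finite Lie algebra with a faithful representation admitting a basis in which every element acts by a finite matrix. Locally reductive: union of nested finite-dimensional reductive subalgebras $\mathfrak g_n\subset\mathfrak g_{n+1}$ with $\mathfrak g_n$ reductive in $\mathfrak g_{n+1}$ (i.e. $\mathfrak g_{n+1}$ is a semisimple $\mathfrak g_n$-module). Borel subalgebra: maximal locally solvable subalgebra, where locally solvable means every finite subset lies in a finite-dimensional solvable subalgebra. *)

(* Defs.v *)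
From HB Require Import structures.
From mathcomp Require Import all_boot all_order all_algebra.
Set Implicit Arguments. Unset Strict Implicit. Unset Printing Implicit Defensive.
Import Order.TTheory GRing.Theory Num.Theory.
Local Open Scope ring_scope.

Section Lie.
Variables (F : fieldType) (L : lmodType F).

Definition is_lie_bracket (br : L -> L -> L) : Prop :=
  [/\ (forall x, linear (br x)),
      (forall y, linear (fun x => br x y)),
      (forall x, br x x = 0) &
      (forall x y z, br x (br y z) + br y (br z x) + br z (br x y) = 0)].

Definition subset_of (S T : L -> Prop) : Prop := forall x, S x -> T x.

Definition span (S : L -> Prop) (v : L) : Prop :=
  exists s : seq (F * L), (forall p, p \in s -> S p.2) /\
                          v = \sum_(p <- s) p.1 *: p.2.

Definition is_subspace (S : L -> Prop) : Prop :=
  [/\ S 0, (forall x y, S x -> S y -> S (x + y)) &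
      (forall (a : F) x, S x -> S (a *: x))].

Definition is_subalgebra (br : L -> L -> L) (S : L -> Prop) : Prop :=
  is_subspace S /\ (forall x y, S x -> S y -> S (br x y)).

Definition fin_dim (S : L -> Prop) : Prop :=
  exists s : seq L, forall v, S v <-> span (fun x => x \in s) v.

Definition countable_dim (S : L -> Prop) : Prop :=
  exists f : nat -> L, forall v, S v <-> span (fun x => exists n, x = f n) v.

Definition derived (br : L -> L -> L) (S : L -> Prop) : L -> Prop :=
  span (fun z => exists x y, [/\ S x, S y & z = br x y]).

Definition solvable_alg (br : L -> L -> L) (S : L -> Prop) : Prop :=
  exists n, forall v, iter n (derived br) S v -> v = 0.

Definition locally_solvable (br : L -> L -> L) (S : L -> Prop) : Prop :=
  forall s : seq L, (forall x, x \in s -> S x) ->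
    exists T : L -> Prop, [/\ is_subalgebra br T, subset_of T S, fin_dim T,
                              solvable_alg br T & forall x, x \in s -> T x].

Definition is_Borel (br : L -> L -> L) (A B : L -> Prop) : Prop :=
  [/\ is_subalgebra br B, subset_of B A, locally_solvable br B &
      forall C, is_subalgebra br C -> subset_of C A -> locally_solvable br C ->
                subset_of B C -> subset_of C B].

Definition semisimple_module (br : L -> L -> L) (A B : L -> Prop) : Prop :=
  forall W, is_subspace W -> subset_of W B ->
    (forall x w, A x -> W w -> W (br x w)) ->
    exists W', [/\ is_subspace W', subset_of W' B,
                   (forall x w, A x -> W' w -> W' (br x w)),
                   (forall v, W v -> W' v -> v = 0) &
                   (forall v, B v -> exists w w', [/\ W w, W' w' & v = w + w'])].

Definition reductive_in (br : L -> L -> L) (A B : L -> Prop) : Prop :=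
  semisimple_module br A B.
Definition reductive (br : L -> L -> L) (A : L -> Prop) : Prop :=
  reductive_in br A A.

Definition locally_reductive (br : L -> L -> L) : Prop :=
  exists g : nat -> (L -> Prop),
    (forall n, is_subalgebra br (g n)) /\
    (forall n, fin_dim (g n)) /\
    (forall n, reductive br (g n)) /\
    (forall n, subset_of (g n) (g n.+1)) /\
    (forall n, reductive_in br (g n) (g n.+1)) /\
    (forall x, exists n, g n x).

Definition finitary (br : L -> L -> L) : Prop :=
  exists (V : lmodType F) (rho : L -> V -> V) (I : eqType) (e : I -> V),
    (forall (a : F) x y v, rho (a *: x + y) v = a *: rho x v + rho y v) /\
    (forall x, linear (rho x)) /\
    (forall x y v, rho (br x y) v = rho x (rho y v) - rho y (rho x v)) /\
    (forall x, (forall v, rho x v = 0) -> x = 0) /\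
        (forall (s : seq I) (c : I -> F), uniq s ->
            \sum_(i <- s) c i *: e i = 0 -> forall i, i \in s -> c i = 0) /\
        (forall v, exists (s : seq I) (c : I -> F), v = \sum_(i <- s) c i *: e i) /\
        (forall x, exists s : seq I, forall i,
            (i \notin s -> rho x (e i) = 0) /\
            exists c : I -> F, rho x (e i) = \sum_(j <- s) c j *: e j).

End Lie.

(* Main.v *)
(* Let [c] lie in a locally solvable subalgebra [C] of [[g, g]] containing
   [b /\ [g, g]].  The ideals [J m] of [g m] generated by [c] form an increasing
   chain of perfect centreless ideals whose union [S] is an ideal of [g] inside
   [[g, g]].  Splitting [x = j + z] in [g m] with [j] in [J m] and [z]
   centralizing [J m], the operator [z] is controlled by its restriction to the
   finite-dimensional image of [c] in the finitary module; reductivity of [g m]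
   in [g m.+1] then shows that all but finitely many directions of [b] act on
   [S] as elements of [S], which lie in [b] by maximality.  Hence the normalizer
   of [C /\ S] in [b] has finite codimension in [b].  For each remaining
   direction [x] one replaces [C /\ S] by its limit under [exp (t ad x)] as [t]
   goes to infinity: the limit is again locally solvable, contains
   [b /\ S], is normalized by [x] and by what normalized [C /\ S], and it lies
   in [b] only if [C /\ S] does.  After finitely many limits the algebra is
   normalized by all of [b], so it lies in [b] by maximality. *)
From HB Require Import structures.
From mathcomp Require Import all_boot all_order all_algebra.
From mathcomp Require Import boolp classical_sets.
Require Import Defs.
Set Implicit Arguments. Unset Strict Implicit. Unset Printing Implicit Defensive.
Import GRing.Theory.
Local Open Scope ring_scope.

(** * Linear algebra *)

(** Maximality of [b] applies only to subalgebras that [b] normalizes, because otherwise their sum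
    with [b] need not be a subalgebra; the difficulty is that [C] need not be stable under [b]. As
    [[b, b]] lies in [b /\ [g, g]], hence in [C], only [b / [b, b]] can move [C]. That quotient may
    be infinite-dimensional, whereas a limit repairs one direction at a time; this is why a single
    [c] is fixed and [C] is cut down to an ideal depending on [c]. Over an abstract closed field of
    characteristic 0 neither [exp] nor the passage of [t] to infinity has a meaning. Growth rates
    are compared by a translation-invariant total order on the additive group of [F], which stands
    in for real parts of eigenvalues, and an exponential polynomial is represented by its
    divided-power coefficients. Limits are computed inside a level [g m] containing [x], which
    [ad x] preserves and where it has finitely many eigenvalues. *)

Section Subspaces.
Variables (F : fieldType) (L : lmodType F).
Implicit Types (S X Y : L -> Prop) (s t : seq L).

Lemma subspace0 S : is_subspace S -> S 0. Proof. by case. Qed.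

Lemma subspaceD S x y : is_subspace S -> S x -> S y -> S (x + y).
Proof. by case=> _ + _; apply. Qed.

Lemma subspaceZ S a x : is_subspace S -> S x -> S (a *: x).
Proof. by case=> _ _; apply. Qed.

Lemma subspaceN S x : is_subspace S -> S x -> S (- x).
Proof. by move=> hS hx; rewrite -scaleN1r; exact: subspaceZ. Qed.

Lemma subspaceB S x y : is_subspace S -> S x -> S y -> S (x - y).
Proof. by move=> hS hx hy; apply: subspaceD => //; exact: subspaceN. Qed.

Lemma subspace_sum S (I : Type) (r : seq I) (P : pred I) (G : I -> L) :
  is_subspace S -> (forall i, P i -> S (G i)) -> S (\sum_(i <- r | P i) G i).
Proof.
move=> hS hG; elim/big_ind: _ => //; first exact: subspace0.
by move=> x y; exact: subspaceD.
Qed.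

Lemma subspace_sum_seq S (I : eqType) (r : seq I) (G : I -> L) :
  is_subspace S -> (forall i, i \in r -> S (G i)) -> S (\sum_(i <- r) G i).
Proof.
by move=> hS hG; rewrite big_seq; apply: subspace_sum.
Qed.

Lemma subspaceI X Y :
  is_subspace X -> is_subspace Y -> is_subspace (fun v => X v /\ Y v).
Proof.
move=> [x0 xD xZ] [y0 yD yZ]; split=> //.
- by move=> u v [? ?] [? ?]; split; [exact: xD | exact: yD].
- by move=> a u [? ?]; split; [exact: xZ | exact: yZ].
Qed.

Lemma subspace_add X Y : is_subspace X -> is_subspace Y ->
  is_subspace (fun v => exists x y, [/\ X x, Y y & v = x + y]).
Proof.
move=> hX hY; split.
- by exists 0, 0; split; [exact: subspace0 | exact: subspace0 | rewrite addr0].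
- move=> _ _ [x [y [xx yy ->]]] [x' [y' [xx' yy' ->]]].
  exists (x + x'), (y + y'); split; [exact: subspaceD | exact: subspaceD |].
  by rewrite addrACA.
- move=> a _ [x [y [xx yy ->]]]; exists (a *: x), (a *: y).
  by split; [exact: subspaceZ | exact: subspaceZ | rewrite scalerDr].
Qed.

Lemma span_subspace S : is_subspace (span S).
Proof.
split.
- by exists [::]; split=> //; rewrite big_nil.
- move=> _ _ [s [hs ->]] [t [ht ->]]; exists (s ++ t); split; last by rewrite big_cat.
  by move=> p; rewrite mem_cat => /orP[/hs|/ht].
- move=> a _ [s [hs ->]]; exists [seq (a * p.1, p.2) | p <- s]; split.
    by move=> _ /mapP[p /hs ? ->].
  by rewrite big_map scaler_sumr; apply: eq_bigr => p _; rewrite scalerA.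
Qed.

Lemma span_sub S Y : is_subspace Y -> subset_of S Y -> subset_of (span S) Y.
Proof.
move=> hY hS _ [s [hs ->]]; apply: subspace_sum_seq => // p /hs/hS.
exact: subspaceZ.
Qed.

Lemma mem_span S x : S x -> span S x.
Proof.
move=> Sx; exists [:: (1, x)]; split; last by rewrite big_seq1 scale1r.
by move=> p; rewrite inE => /eqP ->.
Qed.

Lemma span_mono S X : subset_of S X -> subset_of (span S) (span X).
Proof.
by move=> h; apply: (span_sub (span_subspace X)) => x /h; exact: mem_span.
Qed.

Lemma fin_dim_subspace S : fin_dim S -> is_subspace S.
Proof.
move=> [s hs]; have [h0 hD hZ] := span_subspace (fun x => x \in s); split.
- exact/hs.
- by move=> x y /hs hx /hs hy; apply/hs/hD.
- by move=> a x /hs hx; apply/hs/hZ.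
Qed.

Lemma span_cons a s v : span (fun x => x \in a :: s) v ->
  exists (c : F) w, span (fun x => x \in s) w /\ v = c *: a + w.
Proof.
have hs := span_subspace (fun x => x \in s).
apply: (@span_sub _ (fun v => exists (c : F) w,
  span (fun x => x \in s) w /\ v = c *: a + w)).
  split.
  - by exists 0, 0; split; [exact: subspace0 | rewrite scale0r addr0].
  - move=> _ _ [c [w [hw ->]]] [c' [w' [hw' ->]]]; exists (c + c'), (w + w').
    by split; [exact: subspaceD | rewrite scalerDl addrACA].
  - move=> k _ [c [w [hw ->]]]; exists (k * c), (k *: w).
    by split; [exact: subspaceZ | rewrite scalerDr scalerA].
move=> x; rewrite inE => /orP[/eqP -> | xs].
  by exists 1, 0; split; [exact: subspace0 | rewrite scale1r addr0].
by exists 0, x; split; [exact: mem_span | rewrite scale0r add0r].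
Qed.

Lemma span_consP a s c w :
  span (fun x => x \in s) w -> span (fun x => x \in a :: s) (c *: a + w).
Proof.
have hs := span_subspace (fun x => x \in a :: s).
move=> hw; apply: subspaceD => //.
  by apply: subspaceZ => //; apply: mem_span; rewrite inE eqxx.
by apply: span_mono hw => x xs; rewrite inE xs orbT.
Qed.

Lemma fin_dim_sub S Y :
  fin_dim S -> is_subspace Y -> subset_of Y S -> fin_dim Y.
Proof.
move=> [s hs] hY hYS.
have {hYS} : subset_of Y (span (fun x => x \in s)) by move=> v /hYS /hs.
elim: s Y hY {hs S} => [|a s IH] Y hY hYs.
  exists [::] => v; split; first exact: hYs.
  by apply: span_sub.
have [||t ht] := IH (fun v => Y v /\ span (fun x => x \in s) v).
- by apply: subspaceI => //; exact: span_subspace.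
- by move=> v [].
have tY v : span (fun x => x \in t) v -> Y v by move/ht => [].
(* One vector of [Y] with a nonzero coefficient on [a], if there is any, completes generators of the
   part of [Y] inside the span of [s]. *)
have [[v [c [w [Yv hw vE c0]]]] | hn] := EM (exists v c w,
   [/\ Y v, span (fun x => x \in s) w, v = c *: a + w & c != 0]).
  exists (v :: t) => u; split.
    move=> Yu; have [c' [w' [hw' uE]]] := span_cons (hYs _ Yu).
    have -> : u = (c' / c) *: v + (u - (c' / c) *: v) by rewrite addrC subrK.
    apply: span_consP; apply/ht; split.
      by apply: subspaceB => //; exact: subspaceZ.
    rewrite uE vE scalerDr scalerA divfK // opprD addrACA subrr add0r.
    have hS := span_subspace (fun x => x \in s).
    by apply: subspaceB => //; exact: subspaceZ.
  apply: span_sub => // x; rewrite inE => /orP[/eqP -> // | xt].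
  by apply: tY; exact: mem_span.
exists t => v; split; last exact: tY.
move=> Yv; apply/ht; split=> //.
have [c [w [hw vE]]] := span_cons (hYs _ Yv).
have [c0 | c0] := eqVneq c 0; first by rewrite vE c0 scale0r add0r.
by case: hn; exists v, c, w.
Qed.

Lemma fin_dim_span s : fin_dim (span (fun x => x \in s)).
Proof. by exists s. Qed.

Lemma fin_dim_add X Y : fin_dim X -> fin_dim Y ->
  fin_dim (fun v => exists x y, [/\ X x, Y y & v = x + y]).
Proof.
move=> [s hs] [t ht]; exists (s ++ t) => v.
have hst := span_subspace (fun x => x \in s ++ t); split.
  move=> [x [y [/hs xs /ht yt ->]]]; apply: subspaceD => //.
    by apply: span_mono xs => z zs; rewrite mem_cat zs.
  by apply: span_mono yt => z zs; rewrite mem_cat zs orbT.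
have hX : is_subspace X by apply: fin_dim_subspace; exists s.
have hY : is_subspace Y by apply: fin_dim_subspace; exists t.
apply: (span_sub (subspace_add hX hY)).
move=> x; rewrite mem_cat => /orP[xs | xt].
  exists x, 0; rewrite addr0; split=> //; last exact: subspace0.
  by apply/hs; exact: mem_span.
exists 0, x; rewrite add0r; split=> //; first exact: subspace0.
by apply/ht; exact: mem_span.
Qed.

Lemma span_coord s v : span (fun x => x \in s) v ->
  exists c : 'I_(size s) -> F, v = \sum_i c i *: s`_i.
Proof.
elim: s v => [|a s IH] v.
  move=> hv; exists (fun _ => 0); rewrite big_ord0.
  apply: (@span_sub (fun x => x \in [::]) (fun x => x = 0)) hv => //.
  by split=> // [x y -> -> | k x ->]; rewrite ?addr0 ?scaler0.
move=> /span_cons[k [w [/IH[c ->] ->]]].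
exists (fun i => if unlift ord0 i is Some j then c j else k).
rewrite big_ord_recl unlift_none; congr (_ + _).
by apply: eq_bigr => i _; rewrite liftK.
Qed.

Lemma row_dependence m n (A : 'M[F]_(m, n)) : (n < m)%N ->
  exists a : 'I_m -> F, (exists i, a i != 0) /\ forall j, \sum_i a i * A i j = 0.
Proof.
move=> nm; have : kermx A != 0.
  rewrite -mxrank_eq0 mxrank_ker -lt0n subn_gt0.
  exact: leq_ltn_trans (rank_leq_col A) nm.
case/rowV0Pn => a /sub_kermxP aA /eqP a0; exists (a ord0); split.
  apply: contrapT => h; apply: a0; apply/rowP => i; rewrite mxE.
  by apply/eqP; apply: contrapT => /negP ai; apply: h; exists i.
by move=> j; have := congr1 (fun B : 'rV_n => B ord0 j) aA; rewrite !mxE.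
Qed.

Lemma linear_dependence s m (v : 'I_m -> L) : (size s < m)%N ->
  (forall i, span (fun x => x \in s) (v i)) ->
  exists a : 'I_m -> F, (exists i, a i != 0) /\ \sum_i a i *: v i = 0.
Proof.
move=> sm hv; have [c hc] := choice (fun i => span_coord (hv i)).
have [a [a0 aA]] := @row_dependence m (size s) (\matrix_(i, j) c i j) sm.
exists a; split=> //; under eq_bigr do rewrite hc scaler_sumr.
rewrite exchange_big /= big1 // => j _; rewrite -[RHS](scale0r s`_j) -(aA j).
by rewrite scaler_suml; apply: eq_bigr => i _; rewrite mxE scalerA.
Qed.

(** A family in [X] independent modulo [Y] has fewer than [N] members, so greedy extension stops,
    and it can stop only when the family spans [X] modulo [Y]. *)
Lemma finite_codim X Y N : is_subspace Y -> is_subspace X ->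
  (forall v : 'I_N -> L, (forall i, X (v i)) ->
     exists a : 'I_N -> F, (exists i, a i != 0) /\ Y (\sum_i a i *: v i)) ->
  exists s : seq L, (forall x, x \in s -> X x) /\
    forall x, X x -> exists y, Y y /\ span (fun z => z \in s) (x - y).
Proof.
move=> hY hX hN.
(* [v] is independent modulo [Y] and [k] counts the members that may still be added; [k = 0]
   contradicts [hN]. *)
suff H k r (v : 'I_r -> L) : (r + k)%N = N -> (forall i, X (v i)) ->
    (forall a : 'I_r -> F, Y (\sum_i a i *: v i) -> forall i, a i = 0) ->
    exists s : seq L, (forall x, x \in s -> X x) /\
      forall x, X x -> exists y, Y y /\ span (fun z => z \in s) (x - y).
  by apply: (H N 0%N (fun _ => 0)) => // [[]|a _ []].
elim: k r v => [|k IH] r v rk hv hi.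
  rewrite addn0 in rk; case: N / rk hN => /(_ v hv)[a [[i ai] /hi/(_ i)]].
  by move=> a0; rewrite a0 eqxx in ai.
have [h | hn] := EM (forall x, X x ->
    exists y, Y y /\ span (fun z => z \in codom v) (x - y)).
  by exists (codom v); split=> // x /codomP[i ->].
have [x Xx hx] : exists2 x, X x &
    ~ exists y, Y y /\ span (fun z => z \in codom v) (x - y).
  apply: contrapT => h; apply: hn => x Xx; apply: contrapT => h'.
  by apply: h; exists x.
pose w (i : 'I_r.+1) := if unlift ord0 i is Some j then v j else x.
apply: (IH r.+1 w); first by rewrite addSnnS.
  by move=> i; rewrite /w; case: unliftP.
move=> a; rewrite big_ord_recl {1}/w unlift_none.
under eq_bigr do rewrite /w liftK.
set z := \sum_i _ => Ya.
have hz : span (fun z => z \in codom v) z.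
  apply: subspace_sum; first exact: span_subspace.
  move=> i _; apply: subspaceZ; first exact: span_subspace.
  by apply: mem_span; exact: codom_f.
have a0 : a ord0 = 0.
  apply/eqP; apply: contrapT => /negP a0; apply: hx.
  exists ((a ord0)^-1 *: (a ord0 *: x + z)); split; first exact: subspaceZ.
  rewrite scalerDr scalerA mulVf // scale1r opprD addrA subrr add0r.
  by apply: subspaceN; [exact: span_subspace | apply: subspaceZ; first exact: span_subspace].
move=> i; case: (unliftP ord0 i) => [j -> | -> //].
apply: (hi (fun j => a (lift ord0 j))).
by rewrite a0 scale0r add0r in Ya.
Qed.

End Subspaces.

(** * Total orders on torsion-free groups *)

Definition positive_cone (V : zmodType) (P : V -> Prop) :=
  ~ P 0 /\ forall x y, P x -> P y -> P (x + y).

(** Zorn gives a maximal cone [P]. If it misses both [x] and [- x], maximality puts a negative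
    multiple and a positive multiple of [x] into [P], and suitable multiples of these add up to
    0. *)
Lemma total_cone (V : zmodType) :
  (forall (x : V) n, x != 0 -> x *+ n.+1 != 0) ->
  exists P : V -> Prop, positive_cone P /\ forall x, x != 0 -> P x \/ P (- x).
Proof.
move=> tf.
have cone_muln (P : V -> Prop) x n : positive_cone P -> P x -> P (x *+ n.+1).
  by move=> [_ hD] Px; elim: n => [|n IH]; rewrite ?mulr1n // mulrS; exact: hD.
have [A AP Atot|P [coneP maxP]] := @Zorn_bigcup V (fun A => positive_cone A).
  split=> [[X AX X0] | x y [X AX Xx] [Y AY Yy]]; first by case: (AP X AX).
  by case: (Atot X Y AX AY) => [/(_ _ Xx)|/(_ _ Yy)] ?;
     [exists Y | exists X] => //; apply: (AP _ _).2.
exists P; split=> // x x0.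
(* The cone [Q] generated by [P] and [y] is strictly larger than [P], so it must contain 0; since
   [y] has no torsion, this comes from some [p + y *+ n.+1 = 0]. *)
have extend y : y != 0 -> ~ P y -> exists n, P (- (y *+ n.+1)).
  move=> y0 nPy; apply: contrapT => hn.
  pose Q z := P z \/ exists n, z = y *+ n.+1 \/ exists2 p, P p & z = p + y *+ n.+1.
  apply: (maxP Q).
    split=> [z|]; first by left.
    by move/(_ y) => h; apply: nPy; apply: h; right; exists 0%N; left; rewrite mulr1n.
  case: coneP => P0 PD; split.
    case=> // -[n [/eqP | [p Pp /eqP]]].
      by rewrite eq_sym (negPf (tf _ _ y0)).
    rewrite eq_sym addr_eq0 => /eqP pE; apply: hn; exists n.
    by rewrite -pE.
  move=> u v [Pu | [n [-> | [p Pp ->]]]] [Pv | [m [-> | [q Pq ->]]]].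
  - by left; exact: PD.
  - by right; exists m; right; exists u.
  - by right; exists m; right; exists (u + q); [exact: PD | rewrite addrA].
  - by right; exists n; right; exists v; rewrite // addrC.
  - by right; exists (n + m.+1)%N; left; rewrite -mulrnDr addSn.
  - right; exists (n + m.+1)%N; right; exists q => //.
    by rewrite addrCA -mulrnDr addSn.
  - right; exists n; right; exists (p + v); first exact: PD.
    by rewrite addrAC.
  - right; exists (n + m.+1)%N; right; exists p => //.
    by rewrite -addrA -mulrnDr addSn.
  - right; exists (n + m.+1)%N; right; exists (p + q); first exact: PD.
    by rewrite addrACA -mulrnDr addSn.
apply: contrapT => /not_orP[nx nNx].
have [n Pn] := extend x x0 nx.
have [|m Pm] := extend (- x) _ nNx; first by rewrite oppr_eq0.
case: (coneP) => P0 PD; apply: P0.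
have := PD _ _ (cone_muln _ _ m coneP Pn) (cone_muln _ _ n coneP Pm).
by rewrite !mulNrn !opprK -!mulrnA [(n.+1 * _)%N]mulnC addrC subrr.
Qed.

(** * Generalized eigenspaces *)

Section GeneralizedEigenspaces.
Variables (F : fieldType) (L : lmodType F) (D : L -> L).
Hypothesis Dlin : linear D.
Implicit Types (A B : F -> Prop) (s t : seq F) (Y : L -> Prop).

Definition shift_op (a : F) (v : L) : L := D v - a *: v.
Local Notation T := shift_op.

Lemma linop_comb a u v : D (a *: u + v) = a *: D u + D v. Proof. exact: Dlin. Qed.
Lemma linop_add u v : D (u + v) = D u + D v.
Proof. by have := linop_comb 1 u v; rewrite !scale1r. Qed.
Lemma linop0 : D 0 = 0.
Proof. by apply: (addrI (D 0)); rewrite -linop_add !addr0. Qed.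
Lemma linop_scale a u : D (a *: u) = a *: D u.
Proof. by have := linop_comb a u 0; rewrite linop0 !addr0. Qed.
Lemma linop_opp u : D (- u) = - D u.
Proof. by rewrite -scaleN1r linop_scale scaleN1r. Qed.

Lemma shift_opD a u v : T a (u + v) = T a u + T a v.
Proof. by rewrite /T linop_add scalerDr opprD addrACA. Qed.
Lemma shift_opZ a k u : T a (k *: u) = k *: T a u.
Proof. by rewrite /T linop_scale scalerBr !scalerA mulrC. Qed.
Lemma shift_op0 a : T a 0 = 0.
Proof. by rewrite /T linop0 scaler0 subr0. Qed.
Lemma shift_opN a u : T a (- u) = - T a u.
Proof. by rewrite -scaleN1r shift_opZ scaleN1r. Qed.
Lemma shift_opB a u v : T a (u - v) = T a u - T a v.
Proof. by rewrite shift_opD shift_opN. Qed.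
Lemma shift_opC a b u : T a (T b u) = T b (T a u).
Proof.
rewrite /T !(linop_add, linop_opp, linop_scale) !scalerBr !scalerA !opprB [b * a]mulrC !addrA.
by rewrite [LHS]addrAC [RHS]addrAC; congr (_ + _); rewrite addrAC.
Qed.

Definition kills s v : Prop := foldr T v s = 0.

Lemma foldr_shiftC a s v : T a (foldr T v s) = foldr T (T a v) s.
Proof. by elim: s => //= b s <-; rewrite shift_opC. Qed.

Lemma foldr_shiftCC s t v : foldr T (foldr T v s) t = foldr T (foldr T v t) s.
Proof. by elim: s => //= b s IH; rewrite -foldr_shiftC IH. Qed.

Lemma kills_cons a s v : kills (a :: s) v <-> kills s (T a v).
Proof. by rewrite /kills /= foldr_shiftC. Qed.

Lemma foldr_shift0 s : foldr T 0 s = 0.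
Proof. by elim: s => //= b s ->; rewrite shift_op0. Qed.

Lemma foldr_shiftD s u v : foldr T (u + v) s = foldr T u s + foldr T v s.
Proof. by elim: s => //= b s ->; rewrite shift_opD. Qed.

Lemma foldr_shiftZ s k u : foldr T (k *: u) s = k *: foldr T u s.
Proof. by elim: s => //= b s ->; rewrite shift_opZ. Qed.

Lemma kills_catl s t v : kills s v -> kills (t ++ s) v.
Proof. by rewrite /kills foldr_cat => ->; exact: foldr_shift0. Qed.

Lemma kills_catr s t v : kills s v -> kills (s ++ t) v.
Proof.
by rewrite /kills foldr_cat foldr_shiftCC => ->; exact: foldr_shift0.
Qed.

(** The sum of the generalized eigenspaces of [D] for eigenvalues in [A]; entries of [s] may repeat,
    which accounts for multiplicities. *)
Definition geig A v := exists2 s, (forall a, a \in s -> A a) & kills s v.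

Lemma geig_subspace A : is_subspace (geig A).
Proof.
split.
- by exists [::].
- move=> u v [s sA su] [t tA tv]; exists (s ++ t).
    by move=> a; rewrite mem_cat => /orP[/sA|/tA].
  rewrite /kills foldr_shiftD.
  by have := kills_catr t su; have := kills_catl s tv; rewrite /kills => -> ->; rewrite addr0.
- by move=> k v [s sA sv]; exists s => //; rewrite /kills foldr_shiftZ sv scaler0.
Qed.

Lemma geig_shift A a v : geig A v -> geig A (T a v).
Proof.
by move=> [s sA sv]; exists s => //; rewrite /kills -foldr_shiftC sv shift_op0.
Qed.

Definition stable Y := forall v, Y v -> Y (D v).

Lemma stable_shift Y a v : is_subspace Y -> stable Y -> Y v -> Y (T a v).
Proof. by move=> hY sY Yv; apply: subspaceB => //; [exact: sY | exact: subspaceZ]. Qed.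

(** By induction [v] is an honest eigenvector for some [a] in [A], so each factor [T b] with [b] in
    [B] multiplies it by the nonzero scalar [a - b]. *)
Lemma geig_disjoint A B v : (forall a, A a -> ~ B a) -> geig A v -> geig B v -> v = 0.
Proof.
move=> AB [s sA sv]; elim: s v sA sv => // a s IH v sA /kills_cons sv Bv.
have Dv : T a v = 0.
  apply: IH => //; last exact: geig_shift.
  by move=> b bs; apply: sA; rewrite inE bs orbT.
have {sA} aA : A a by apply: sA; rewrite inE eqxx.
case: Bv => t tB; rewrite /kills.
have Tb b : T b v = (a - b) *: v.
  by move/eqP: Dv; rewrite /T subr_eq0 => /eqP ->; rewrite scalerBl.
elim: t tB => [|b t IHt] tB //; move/kills_cons; rewrite /kills Tb foldr_shiftZ.
move/eqP; rewrite scaler_eq0 => /orP[|/eqP]; last first.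
  by apply: IHt => c ct; apply: tB; rewrite inE ct orbT.
rewrite subr_eq0 => /eqP ab; case: (AB b); first by rewrite -ab.
by apply: tB; rewrite inE eqxx.
Qed.

(** [T a] is invertible where a product of other factors vanishes, with inverse a polynomial in [D];
    the clause on [Y] records that this polynomial preserves stable subspaces. *)
Lemma shift_op_solve a t w : a \notin t -> kills t w ->
  exists u, [/\ T a u = w, kills t u &
    forall Y, is_subspace Y -> stable Y -> Y w -> Y u].
Proof.
elim: t w => [|b t IH] w.
  by rewrite /kills /= => _ w0; exists w; split=> //; rewrite w0 shift_op0.
rewrite inE negb_or => /andP[ab /IH{}IH] /kills_cons hw.
have [u1 [u1E u1t u1Y]] := IH _ hw.
have ab0 : a - b != 0 by rewrite subr_eq0.
have aD : T b w - T a w = (a - b) *: w.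
  by rewrite /T opprB addrC addrA subrK scalerBl.
(* [T a u1 = T b w], and [T b w - T a w] is [(a - b) *: w]. *)
exists ((a - b)^-1 *: (u1 - w)); split.
- by rewrite shift_opZ shift_opB u1E aD scalerA mulVf // scale1r.
- rewrite kills_cons /kills shift_opZ foldr_shiftZ shift_opB.
  rewrite -scaleN1r foldr_shiftD foldr_shiftZ hw scaler0 addr0.
  by rewrite -foldr_shiftC u1t shift_op0 scaler0.
- move=> Y hY sY Yw; apply: subspaceZ => //; apply: subspaceB => //.
  by apply: u1Y => //; exact: stable_shift.
Qed.

(** Primary decomposition, one factor at a time: the component of [T a v] whose factors exclude [a]
    is lifted through [T a] by [shift_op_solve], and the other component absorbs the rest. *)
Lemma kills_split (p : pred F) s v : kills s v ->
  exists v1 v2, [/\ v = v1 + v2, kills [seq a <- s | p a] v1,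
    kills [seq a <- s | ~~ p a] v2 &
    forall Y, is_subspace Y -> stable Y -> Y v -> Y v1 /\ Y v2].
Proof.
elim: s v => [|a s IH] v.
  move=> v0; exists v, v; split=> //; have -> : v = 0 by []; by rewrite addr0.
move/kills_cons/IH => [w1 [w2 [wE w1s w2s wY]]] /=.
case: ifP => pa /=.
  have [|u [uE us uY]] := shift_op_solve (a := a) _ w2s.
    by rewrite mem_filter pa.
  exists (v - u), u; split=> //; first by rewrite subrK.
    by apply/kills_cons; rewrite shift_opB wE uE addrK.
  move=> Y hY sY Yv.
  have [_ Y2] := wY Y hY sY (stable_shift a hY sY Yv).
  have Yu := uY _ hY sY Y2.
  by split=> //; exact: subspaceB.
have [|u [uE us uY]] := shift_op_solve (a := a) _ w1s.
  by rewrite mem_filter pa.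
exists u, (v - u); split=> //; first by rewrite addrC subrK.
  by apply/kills_cons; rewrite shift_opB wE uE addrC addKr.
move=> Y hY sY Yv.
have [Y1 _] := wY Y hY sY (stable_shift a hY sY Yv).
have Yu := uY _ hY sY Y1.
by split=> //; exact: subspaceB.
Qed.

End GeneralizedEigenspaces.

(** The iterates of [D] on [v] are linearly dependent, so [v] is killed by a nonzero polynomial in
    [D], which splits over a closed field. Below, [act q] is [q (D) v]. *)
Lemma fin_dim_kills (F : closedFieldType) (L : lmodType F) (D : L -> L)
    (G : L -> Prop) v :
  linear D -> fin_dim G -> stable D G -> G v -> exists s, kills D s v.
Proof.
move=> Dlin [s hs] sG Gv.
have hv i : G (iter i D v) by elim: i => // i IH; exact: sG.
have [a [[i ai] aE]] := @linear_dependence _ _ s (size s).+1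
  (fun i => iter i D v) (leqnn _) (fun i => (hs _).1 (hv i)).
pose p := \poly_(i < (size s).+1) a (inord i).
pose act (q : {poly F}) := \sum_(i < size q) q`_i *: iter i D v.
have actE n (q : {poly F}) : (size q <= n)%N -> act q = \sum_(i < n) q`_i *: iter i D v.
  move=> qn; rewrite /act.
  rewrite (big_ord_widen n (fun i => q`_i *: iter i D v) qn) big_mkcond /=.
  apply: eq_bigr => j _; case: ltnP => // jq.
  by rewrite nth_default // scale0r.
have actZ c q : act (c *: q) = c *: act q.
  rewrite (@actE (size q) (c *: q)) ?size_scale_leq // /act scaler_sumr.
  by apply: eq_bigr => j _; rewrite coefZ scalerA.
have actM c q : act (('X - c%:P) * q) = shift_op D c (act q).
  rewrite (@actE (size q).+1); last first.
    by apply: leq_trans (size_polyMleq _ _) _; rewrite size_XsubC.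
  rewrite /shift_op.
  have -> : D (act q) = \sum_(i < size q) q`_i *: iter i.+1 D v.
    rewrite /act; elim/big_rec2: _ => [|j y1 y2 _ <-]; first exact: linop0.
    by rewrite Dlin.
  transitivity (\sum_(i < (size q).+1) ('X * q)`_i *: iter i D v - c *: act q).
    rewrite (@actE (size q).+1 q) // scaler_sumr -sumrB; apply: eq_bigr => j _.
    by rewrite mulrBl coefB coefCM scalerBl scalerA.
  rewrite big_ord_recl coefXM /= scale0r add0r; congr (_ - _).
  by apply: eq_bigr => j _; rewrite coefXM.
have act0 : act p = 0.
  rewrite (@actE (size s).+1) ?size_poly // -[RHS]aE; apply: eq_bigr => j _.
  by rewrite coef_poly ltn_ord inord_val.
have p0 : p != 0.
  apply/eqP => /(congr1 (fun q : {poly F} => q`_i)).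
  by rewrite coef_poly ltn_ord inord_val coef0; apply/eqP.
have [r rE] := closed_field_poly_normal p.
exists r; rewrite /kills.
have rprod (t : seq F) : act (\prod_(z <- t) ('X - z%:P)) = foldr (shift_op D) v t.
  elim: t => [|z t IH]; last by rewrite big_cons actM IH.
  by rewrite big_nil /act size_poly1 big_ord1 coef1 scale1r.
have := act0; rewrite rE actZ rprod => /eqP; rewrite scaler_eq0 lead_coef_eq0 (negPf p0).
by move/eqP.
Qed.

(** * Bilinearity, antisymmetry and the Jacobi identity *)

Section Bracket.
Variables (F : fieldType) (L : lmodType F) (br : L -> L -> L).
Hypothesis hbr : is_lie_bracket br.

Lemma lie_linearl y : linear (br^~ y).
Proof. by case: hbr => _ + _ _; apply. Qed.
Lemma lie_linearr x : linear (br x).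
Proof. by case: hbr. Qed.
Lemma lieDl x y z : br (x + y) z = br x z + br y z.
Proof. exact: (linop_add (lie_linearl z)). Qed.
Lemma lieDr x y z : br x (y + z) = br x y + br x z.
Proof. exact: (linop_add (lie_linearr x)). Qed.
Lemma lieZl a x z : br (a *: x) z = a *: br x z.
Proof. exact: (linop_scale (lie_linearl z)). Qed.
Lemma lieZr a x z : br x (a *: z) = a *: br x z.
Proof. exact: (linop_scale (lie_linearr x)). Qed.
Lemma lie0l z : br 0 z = 0.
Proof. exact: (linop0 (lie_linearl z)). Qed.
Lemma lie0r x : br x 0 = 0.
Proof. exact: (linop0 (lie_linearr x)). Qed.
Lemma lieNl x z : br (- x) z = - br x z.
Proof. exact: (linop_opp (lie_linearl z)). Qed.
Lemma lieNr x z : br x (- z) = - br x z.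
Proof. exact: (linop_opp (lie_linearr x)). Qed.
Lemma lieBl x y z : br (x - y) z = br x z - br y z.
Proof. by rewrite lieDl lieNl. Qed.
Lemma lieBr x y z : br x (y - z) = br x y - br x z.
Proof. by rewrite lieDr lieNr. Qed.
Lemma liexx x : br x x = 0. Proof. by case: hbr. Qed.
Lemma lieC x y : br x y = - br y x.
Proof.
apply/eqP; rewrite -addr_eq0; apply/eqP.
by have := liexx (x + y); rewrite lieDl !lieDr !liexx add0r addr0.
Qed.
Lemma lie_jacobi x y z : br x (br y z) = br (br x y) z + br y (br x z).
Proof.
case: hbr => _ _ _ /(_ x y z) /eqP.
rewrite (lieC z (br x y)) (lieC z x) lieNr -addrA -opprD subr_eq0 => /eqP ->.
by rewrite addrC.
Qed.
Lemma lie_suml (I : Type) (r : seq I) (G : I -> L) y :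
  br (\sum_(i <- r) G i) y = \sum_(i <- r) br (G i) y.
Proof. by elim/big_rec2: _ => [|i u v _ <-]; rewrite ?lie0l ?lieDl. Qed.

Lemma lie_span (X Y Z : L -> Prop) u v : is_subspace Z ->
  (forall x y, X x -> Y y -> Z (br x y)) -> span X u -> span Y v -> Z (br u v).
Proof.
move=> hZ h Xu Yv; move: u Xu; apply: span_sub.
  split=> [|x y|a x]; rewrite ?lie0l ?lieDl ?lieZl.
  - exact: subspace0.
  - exact: subspaceD.
  - exact: subspaceZ.
move=> x Xx; move: v Yv; apply: span_sub; last by move=> y; exact: h.
split=> [|u v|a u]; rewrite ?lie0r ?lieDr ?lieZr.
- exact: subspace0.
- exact: subspaceD.
- exact: subspaceZ.
Qed.

End Bracket.

(** * Limits of subalgebras along a derivation *)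

Section Degeneration.
Variables (F : fieldType) (L : lmodType F) (br : L -> L -> L).
Hypothesis hbr : is_lie_bracket br.
Variable D : L -> L.
Hypothesis Dlin : linear D.
Hypothesis Dder : forall x y, D (br x y) = br (D x) y + br x (D y).
Variable pos : F -> Prop.
Hypothesis pos_cone : positive_cone pos.
Hypothesis pos_total : forall x, x != 0 -> pos x \/ pos (- x).
Hypothesis char0 : forall n, n.+1%:R != 0 :> F.
Implicit Types (p q : nat -> L) (G X Y Z U : L -> Prop) (l m : F).
Local Notation T := (shift_op D).
Local Notation geig := (geig D).

Lemma shift_op_lie l m x y : T (l + m) (br x y) = br (T l x) y + br x (T m y).
Proof.
rewrite /T Dder (lieBl hbr) (lieBr hbr) (lieZl hbr) (lieZr hbr) scalerDl opprD.
by rewrite addrACA.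
Qed.

(** By the Leibniz rule, [T (a + b)] on [br x y] shortens the list killing [x] or the list killing
    [y]; hence induction on the total length. *)
Lemma geig_lie (A B C : F -> Prop) x y : (forall a b, A a -> B b -> C (a + b)) ->
  geig A x -> geig B y -> geig C (br x y).
Proof.
move=> ABC [s sA sx] [t tB ty].
have [n] := ubnP (size s + size t); elim: n s t x y sA sx tB ty => // n IH.
move=> [|a s] [|b t] x y sA sx tB ty.
- by move=> _; rewrite [x]sx (lie0l hbr); exact: (subspace0 (geig_subspace _ _)).
- by move=> _; rewrite [x]sx (lie0l hbr); exact: (subspace0 (geig_subspace _ _)).
- by move=> _; rewrite [y]ty (lie0r hbr); exact: (subspace0 (geig_subspace _ _)).
rewrite /= addSn ltnS => hn.
have sx' : kills D s (T a x) by apply/kills_cons.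
have ty' : kills D t (T b y) by apply/kills_cons.
have sA' c : c \in s -> A c by move=> cs; apply: sA; rewrite inE cs orbT.
have tB' c : c \in t -> B c by move=> ct; apply: tB; rewrite inE ct orbT.
have [r rC rk] : geig C (T (a + b) (br x y)).
  rewrite shift_op_lie; apply: (subspaceD (geig_subspace Dlin _)).
    apply: (IH s (b :: t)) => //=.
  apply: (IH (a :: s) t) => //=; by rewrite addSn -addnS.
exists ((a + b) :: r); last by apply/(kills_cons Dlin).
move=> c; rewrite inE => /orP[/eqP ->|/rC//].
by apply: ABC; [apply: sA | apply: tB]; rewrite inE eqxx.
Qed.

(** The strict order [a < l] given by the cone; it expresses that [exp (a t)] is negligible against
    [exp (l t)]. *)
Definition lower l a := pos (l - a).

(* A sequence [p] encodes the divided-power polynomial [sum_k p_k t^k / k!];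
   [delta l] is [d/dt - (D - l)], so the value at [0] of its [k]-th iterate is
   the [k]-th coefficient of [exp (- t (D - l)) p]. *)
Definition delta l p : nat -> L := fun k => p k.+1 - T l (p k).

(** Meaning: modulo lower eigenvalues, [exp (l t) p (t)] equals [exp (t D)] applied to a series with
    coefficients in [X]. Applying [exp (- t D)], which preserves the lower part, turns this into one
    condition per coefficient. *)
Definition realizes X l p := forall k, exists c,
  X c /\ geig (lower l) (c - iter k (delta l) p 0).

Lemma delta_add l p q :
  delta l (fun k => p k + q k) = fun k => delta l p k + delta l q k.
Proof. by apply/funext => k; rewrite /delta shift_opD // opprD addrACA. Qed.

Lemma delta_scale l a p : delta l (fun k => a *: p k) = fun k => a *: delta l p k.
Proof. by apply/funext => k; rewrite /delta shift_opZ // scalerBr. Qed.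

Lemma iter_delta_add l k p q :
  iter k (delta l) (fun j => p j + q j) =
  fun j => iter k (delta l) p j + iter k (delta l) q j.
Proof. by elim: k => //= k ->; rewrite delta_add. Qed.

Lemma iter_delta_scale l k a p :
  iter k (delta l) (fun j => a *: p j) = fun j => a *: iter k (delta l) p j.
Proof. by elim: k => //= k ->; rewrite delta_scale. Qed.

Lemma realizes_add X l p q : is_subspace X ->
  realizes X l p -> realizes X l q -> realizes X l (fun k => p k + q k).
Proof.
move=> hX hp hq k; have [c [Xc cp]] := hp k; have [d [Xd dq]] := hq k.
exists (c + d); split; first exact: subspaceD.
rewrite iter_delta_add opprD addrACA.
by apply: (subspaceD (geig_subspace Dlin _)).
Qed.

Lemma realizes_scale X l a p : is_subspace X ->
  realizes X l p -> realizes X l (fun k => a *: p k).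
Proof.
move=> hX hp k; have [c [Xc cp]] := hp k.
exists (a *: c); split; first exact: subspaceZ.
rewrite iter_delta_scale -scalerBr.
by apply: (subspaceZ _ (geig_subspace Dlin _)).
Qed.

Lemma realizes_delta X l p : realizes X l p -> realizes X l (delta l p).
Proof. by move=> hp k; rewrite -iterSr; exact: hp. Qed.

Lemma realizes_stable X Y l p : is_subspace Y -> stable D Y -> subset_of Y X ->
  (forall k, Y (p k)) -> realizes X l p.
Proof.
move=> hY sY YX Yp k; exists (iter k (delta l) p 0); split.
  apply: YX; elim: k p Yp => //= k IH p Yp; rewrite -iterS iterSr; apply: IH => j.
  by apply: subspaceB => //; apply: stable_shift.
by rewrite subrr; exact: (subspace0 (geig_subspace Dlin _)).
Qed.

(** The bracket of two divided-power polynomials, whose coefficient [k] is the sum of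
    [br (p i) (q (k - i)) *+ 'C(k, i)]. The shift of a sequence is its derivative, so the Leibniz
    rule serves as the recursion. *)
Fixpoint seq_lie p q k : L :=
  if k is k'.+1 then seq_lie (fun j => p j.+1) q k' + seq_lie p (fun j => q j.+1) k'
  else br (p 0%N) (q 0%N).

Lemma seq_lieBl p p' q k :
  seq_lie (fun j => p j - p' j) q k = seq_lie p q k - seq_lie p' q k.
Proof.
elim: k p p' q => [|k IH] p p' q /=; first by rewrite (lieBl hbr).
by rewrite (IH (fun j => p j.+1) (fun j => p' j.+1)) IH opprD addrACA.
Qed.

Lemma seq_lieBr p q q' k :
  seq_lie p (fun j => q j - q' j) k = seq_lie p q k - seq_lie p q' k.
Proof.
elim: k p q q' => [|k IH] p q q' /=; first by rewrite (lieBr hbr).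
by rewrite IH (IH _ (fun j => q j.+1) (fun j => q' j.+1)) opprD addrACA.
Qed.

Lemma shift_op_seq_lie l m p q k : T (l + m) (seq_lie p q k) =
  seq_lie (fun j => T l (p j)) q k + seq_lie p (fun j => T m (q j)) k.
Proof.
elim: k p q => [|k IH] p q /=; first exact: shift_op_lie.
by rewrite shift_opD // !IH addrACA.
Qed.

Lemma delta_seq_lie l m p q : delta (l + m) (seq_lie p q) =
  fun k => seq_lie (delta l p) q k + seq_lie p (delta m q) k.
Proof.
apply/funext => k; rewrite {1}/delta shift_op_seq_lie /= /delta.
by rewrite seq_lieBl seq_lieBr opprD addrACA.
Qed.

Lemma geig_delta A l p : (forall k, geig A (p k)) -> forall k, geig A (delta l p k).
Proof.
move=> hp k; apply: (subspaceB (geig_subspace Dlin _)) => //.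
exact: geig_shift.
Qed.

(** [delta] obeys the Leibniz rule, so every coefficient reduces to the constant one. There the
    witnesses are [c' + p 0] and [d' + q 0] with [c'], [d'] of lower eigenvalue, and each extra term
    of the bracket lies below [l + m]. *)
Lemma realizes_lie X Y Z l m p q : is_subspace Z ->
  (forall x y, X x -> Y y -> Z (br x y)) ->
  (forall k, geig (eq l) (p k)) -> (forall k, geig (eq m) (q k)) ->
  realizes X l p -> realizes Y m q -> realizes Z (l + m) (seq_lie p q).
Proof.
move=> hZ XYZ gp gq hp hq k; elim: k p q gp gq hp hq => [|k IH] p q gp gq hp hq.
  have [c [Xc cp]] := hp 0%N; have [d [Yd dq]] := hq 0%N.
  exists (br c d); split; first exact: XYZ.
  have [c' cE] : exists c', c = c' + p 0%N by exists (c - p 0%N); rewrite subrK.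
  have [d' dE] : exists d', d = d' + q 0%N by exists (d - q 0%N); rewrite subrK.
  rewrite /= cE addrK in cp; rewrite /= dE addrK in dq.
  rewrite /= cE dE (lieDl hbr) !(lieDr hbr) addrA addrK.
  have hg := geig_subspace Dlin (lower (l + m)).
  apply: subspaceD => //; first apply: subspaceD => //.
  - apply: geig_lie cp dq => a b; rewrite /lower => la mb.
    by rewrite opprD addrACA; apply: pos_cone.2.
  - apply: geig_lie cp (gq 0%N) => a b la <-.
    by rewrite /lower opprD addrACA subrr addr0.
  - apply: geig_lie (gp 0%N) dq => a b <- mb.
    by rewrite /lower opprD addrACA subrr add0r.
rewrite iterSr delta_seq_lie iter_delta_add.
have [c [Zc hc]] := IH _ _ (geig_delta l gp) gq (realizes_delta hp) hq.
have [d [Zd hd]] := IH _ _ gp (geig_delta m gq) hp (realizes_delta hq).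
exists (c + d); split; first exact: subspaceD.
by rewrite opprD addrACA; apply: (subspaceD (geig_subspace Dlin _)).
Qed.

Lemma seq_lie0l q k : seq_lie (fun _ => 0) q k = 0.
Proof. by elim: k q => [|k IH] q /=; [exact: lie0l | rewrite !IH addr0]. Qed.

Lemma seq_lie0r p k : seq_lie p (fun _ => 0) k = 0.
Proof. by elim: k p => [|k IH] p /=; [exact: lie0r | rewrite !IH addr0]. Qed.

Lemma seq_lie_deg e e' p q k : (forall j, (e < j)%N -> p j = 0) ->
  (forall j, (e' < j)%N -> q j = 0) -> (e + e' < k)%N -> seq_lie p q k = 0.
Proof.
elim: k e e' p q => // k IH e e' p q hp hq /= hk.
have -> : seq_lie (fun j => p j.+1) q k = 0.
  case: e hp hk => [|e] hp hk; last exact: (IH e e' _ _ (fun j => hp j.+1) hq hk).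
  have -> : (fun j => p j.+1) = fun _ => 0 by apply/funext => j; exact: hp.
  exact: seq_lie0l.
have -> : seq_lie p (fun j => q j.+1) k = 0; last by rewrite addr0.
case: e' hq hk => [|e'] hq hk.
  have -> : (fun j => q j.+1) = fun _ => 0 by apply/funext => j; exact: hq.
  exact: seq_lie0r.
by apply: (IH e e' _ _ hp (fun j => hq j.+1)); rewrite addnS in hk.
Qed.

(** In top degree the recursion of [seq_lie] is Pascal's rule. The binomial coefficient is
    invertible in characteristic 0, so a bracket of leading coefficients is again a leading
    coefficient. *)
Lemma seq_lie_top e e' p q : (forall j, (e < j)%N -> p j = 0) ->
  (forall j, (e' < j)%N -> q j = 0) ->
  seq_lie p q (e + e') = br (p e) (q e') *+ 'C(e + e', e).
Proof.
have [k] := ubnP (e + e'); elim: k e e' p q => // k IH [|e] [|e'] p q hk hp hq.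
- by rewrite bin0 mulr1n.
- rewrite add0n /=.
  have -> : (fun j => p j.+1) = fun _ => 0 by apply/funext => j; exact: hp.
  rewrite seq_lie0l add0r bin0.
  have := IH 0%N e' p (fun j => q j.+1) hk hp (fun j => hq j.+1).
  by rewrite add0n bin0.
- rewrite addn0 /=.
  have -> : (fun j => q j.+1) = fun _ => 0 by apply/funext => j; exact: hq.
  rewrite seq_lie0r addr0 binn; rewrite addn0 in hk.
  have := IH e 0%N (fun j => p j.+1) q _ (fun j => hp j.+1) hq.
  by rewrite addn0 binn; apply.
- rewrite addSn /= binS mulrnDr addrC; congr (_ + _).
    have := IH e.+1 e' p (fun j => q j.+1) _ hp (fun j => hq j.+1).
    by rewrite addSnnS; apply; rewrite addSn ltnS in hk.
  have := IH e e'.+1 (fun j => p j.+1) q _ (fun j => hp j.+1) hq.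
  by apply; rewrite addSn ltnS in hk.
Qed.

(* The span of the [lead G X l] plays the role of the limit of [exp (t D) X] as
   [t] goes to infinity: an element of [exp (t D) (X[t])] whose term of largest
   exponent is [exp (l t) p (t)] contributes the leading coefficient of [p]. *)
Definition lead G X l w := exists e p,
  [/\ forall k, G (p k) /\ geig (eq l) (p k), forall k, (e < k)%N -> p k = 0,
      p e = w & realizes X l p].

Definition limit G X := span (fun w => exists l, lead G X l w).

Lemma lead_scale G X l a w : is_subspace G -> is_subspace X ->
  lead G X l w -> lead G X l (a *: w).
Proof.
move=> hG hX [e [p [hp pe <- pX]]]; exists e, (fun k => a *: p k); split=> //.
- move=> k; have [? ?] := hp k; split; first exact: subspaceZ.
  exact: (subspaceZ _ (geig_subspace Dlin _)).
- by move=> k /pe ->; rewrite scaler0.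
- exact: realizes_scale.
Qed.

Lemma lead_shift G X l w : is_subspace G -> stable D G -> is_subspace X ->
  lead G X l w -> lead G X l (T l w).
Proof.
move=> hG sG hX [e [p [hp pe <- pX]]]; rewrite -[T l _]opprK -scaleN1r.
apply: lead_scale => //; exists e, (delta l p); split.
- move=> k; split; last by apply: geig_delta => j; case: (hp j).
  by apply: subspaceB => //; [case: (hp k.+1) | apply: stable_shift => //; case: (hp k)].
- move=> k ek; rewrite /delta !pe ?(leqW ek) // shift_op0 // subr0.
  by [].
- by rewrite /delta pe // add0r.
- exact: realizes_delta.
Qed.

(** Three pairs of spaces are allowed because the result is used three times: for the limit being a
    subalgebra, for its derived series, and for its stability under what normalized [X]. *)
Lemma lead_lie G1 G2 G3 X Y Z l m u v :
  is_subspace G3 -> is_subspace Z ->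
  (forall x y, G1 x -> G2 y -> G3 (br x y)) ->
  (forall x y, X x -> Y y -> Z (br x y)) ->
  lead G1 X l u -> lead G2 Y m v -> lead G3 Z (l + m) (br u v).
Proof.
move=> hG hZ hGG hXY [e [p [hp pe <- pX]]] [e' [q [hq qe <- qY]]].
have N0 : 'C(e + e', e)%:R != 0 :> F.
  by rewrite -(@prednK 'C(_, _)) ?bin_gt0 ?leq_addr.
have -> : br (p e) (q e') = 'C(e + e', e)%:R^-1 *: seq_lie p q (e + e').
  by rewrite seq_lie_top // -scaler_nat scalerA mulVf ?scale1r.
apply: lead_scale => //; exists (e + e')%N, (seq_lie p q); split=> //.
- have hp1 k : G1 (p k) by case: (hp k).
  have hq1 k : G2 (q k) by case: (hq k).
  have hp2 k : geig (eq l) (p k) by case: (hp k).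
  have hq2 k : geig (eq m) (q k) by case: (hq k).
  have gS := geig_subspace Dlin (eq (l + m)).
  move=> k; split.
    elim: k p q {hp hq pe qe pX qY hp2 hq2} hp1 hq1 => [|k IH] p q hp1 hq1 /=.
      exact: hGG.
    by apply: subspaceD => //; exact: IH.
  elim: k p q {hp hq pe qe pX qY hp1 hq1} hp2 hq2 => [|k IH] p q hp2 hq2 /=.
    by apply: geig_lie (hp2 _) (hq2 _) => a b <- <-.
  by apply: subspaceD => //; exact: IH.
- by move=> k; exact: seq_lie_deg.
- by apply: realizes_lie pX qY => // k; [case: (hp k) | case: (hq k)].
Qed.

(** The constant coefficient has eigenvalue [l] and also only lower eigenvalues, so it is 0;
    applying this to [delta l q] gives the next coefficients. This ends the derived series of a
    limit and so makes limits of solvable algebras solvable. *)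
Lemma lead0 G X l w : subset_of X (fun v => v = 0) -> lead G X l w -> w = 0.
Proof.
move=> X0 [e [p [hp pe <- pX]]].
have {}hp k : geig (eq l) (p k) by case: (hp k).
have zero k : forall q, (forall k, geig (eq l) (q k)) -> realizes X l q -> q k = 0.
  elim: k => [|k IH] q hq qX.
    have [c [/X0 -> hc]] := qX 0%N; rewrite sub0r /= in hc.
    have disj a : eq l a -> ~ lower l a by move=> <-; rewrite /lower subrr; exact: pos_cone.1.
    apply: (geig_disjoint Dlin disj (hq 0%N)); rewrite -[q 0%N]opprK.
    exact: (subspaceN (geig_subspace Dlin _)).
  have dq : delta l q k = 0.
    by apply: IH; [exact: geig_delta | exact: realizes_delta].
  by move: dq; rewrite /delta (IH q) // shift_op0 // subr0.
exact: zero.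
Qed.

Lemma lead_mono G G' X X' l w : subset_of G G' -> subset_of X X' ->
  lead G X l w -> lead G' X' l w.
Proof.
move=> hG hX [e [p [hp pe <- pX]]]; exists e, p; split=> //.
  by move=> k; have [/hG ? ?] := hp k.
by move=> k; have [c [/hX ? ?]] := pX k; exists c.
Qed.

Lemma limit_mono G G' X X' : subset_of G G' -> subset_of X X' ->
  subset_of (limit G X) (limit G' X').
Proof.
by move=> hG hX; apply: span_mono => w [l hl]; exists l; exact: lead_mono hl.
Qed.

Lemma limit_sub G X : is_subspace G -> subset_of (limit G X) G.
Proof.
move=> hG; apply: span_sub => // w [l [e [p [hp _ <- _]]]].
by case: (hp e).
Qed.

Lemma limit0 G X : subset_of X (fun v => v = 0) ->
  subset_of (limit G X) (fun v => v = 0).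
Proof.
move=> X0; apply: span_sub => [|w [l]]; last exact: lead0.
by split=> // [x y -> ->|a x ->]; rewrite ?addr0 ?scaler0.
Qed.

Lemma limit_lie G1 G2 G3 X Y Z u v :
  is_subspace G3 -> is_subspace Z ->
  (forall x y, G1 x -> G2 y -> G3 (br x y)) ->
  (forall x y, X x -> Y y -> Z (br x y)) ->
  limit G1 X u -> limit G2 Y v -> limit G3 Z (br u v).
Proof.
move=> hG hZ hGG hXY; apply: (lie_span hbr); first exact: span_subspace.
move=> x y [l hl] [m hm]; apply: mem_span; exists (l + m).
exact: lead_lie hl hm.
Qed.

Lemma limit_D G X : is_subspace G -> stable D G -> is_subspace X ->
  stable D (limit G X).
Proof.
move=> hG sG hX v hv; have hS := span_subspace (fun w => exists l, lead G X l w).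
move: v hv; apply: span_sub.
  split=> [|x y|a x]; rewrite ?(linop0 Dlin) ?(linop_add Dlin) ?(linop_scale Dlin).
  - exact: subspace0.
  - exact: subspaceD.
  - exact: subspaceZ.
move=> w [l hl]; have -> : D w = T l w + l *: w by rewrite subrK.
apply: subspaceD => //; first by apply: mem_span; exists l; exact: lead_shift.
by apply: subspaceZ => //; apply: mem_span; exists l.
Qed.

Lemma derived_limit G X : is_subspace G ->
  (forall x y, G x -> G y -> G (br x y)) ->
  subset_of (derived br (limit G X)) (limit G (derived br X)).
Proof.
move=> hG hGG; apply: span_sub; first exact: span_subspace.
move=> _ [u [v [hu hv ->]]]; apply: limit_lie hu hv => //.
  exact: span_subspace.
by move=> x y Xx Xy; apply: mem_span; exists x, y.
Qed.

Lemma iter_derived_limit G X n : is_subspace G ->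
  (forall x y, G x -> G y -> G (br x y)) ->
  subset_of (iter n (derived br) (limit G X)) (limit G (iter n (derived br) X)).
Proof.
move=> hG hGG; elim: n => // n IH v /= hv; apply: derived_limit => //.
move: v hv; apply: span_mono => z [x [y [hx hy ->]]].
by exists x, y; split=> //; exact: IH.
Qed.

Lemma geig_eq_nseq s l v : kills D [seq a <- s | a == l] v ->
  exists n, iter n (T l) v = 0.
Proof.
rewrite /kills; have /all_pred1P -> : all (pred1 l) [seq a <- s | a == l].
  by apply/allP => a; rewrite mem_filter => /andP[].
by move: (size _) => n h; exists n; rewrite -[RHS]h; elim: {h} n => //= n ->.
Qed.

(** [exp (t D)] does not move a stable [X]: each generalized eigencomponent of an element stays in
    [X] and, as a constant polynomial, is its own leading coefficient. *)
Lemma stable_sub_limit G X : is_subspace X -> stable D X -> subset_of X G ->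
  (forall x, X x -> exists s, kills D s x) -> subset_of X (limit G X).
Proof.
move=> hX sX XG hk x Xx; have [s] := hk x Xx.
have [n] := ubnP (size s); elim: n s x Xx => // n IH [|a s] x Xx hn.
  by move=> x0; rewrite [x]x0; exact: (subspace0 (span_subspace _)).
move/(kills_split Dlin (pred1 a)) => [x1 [x2 [xE k1 k2 xY]]].
have [X1 X2] := xY X hX sX Xx; rewrite xE.
apply: (subspaceD (span_subspace _)); last first.
  apply: IH X2 _ k2; rewrite size_filter /= eqxx /= add0n.
  exact: leq_ltn_trans (count_size _ _) (hn : (size s < n)%N).
apply: mem_span; exists a, 0%N, (fun k => if k is 0 then x1 else 0); split=> //.
- have hg : geig (eq a) x1.
    by exists [seq b <- a :: s | pred1 a b] => // b; rewrite mem_filter => /andP[/eqP].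
  case=> [|k]; first by split=> //; exact: XG.
  by split; [apply: XG; exact: subspace0 | exact: (subspace0 (geig_subspace Dlin _))].
- by case.
- by apply: (realizes_stable _ hX sX) => // -[|k] //; exact: subspace0.
Qed.

Lemma max_weight s : s != [::] ->
  exists2 l, l \in s & forall a, a \in s -> a != l -> lower l a.
Proof.
elim: s => // b [|c s] IH _.
  by exists b; rewrite ?inE // => a; rewrite inE => /eqP ->; rewrite eqxx.
have [//|l ls hl] := IH; have [lb|] := EM (lower b l).
  exists b; first by rewrite inE eqxx.
  move=> a; rewrite inE => /orP[/eqP ->|as_ ab]; first by rewrite eqxx.
  have [-> //|al] := eqVneq a l.
  have := pos_cone.2 _ _ lb (hl a as_ al).
  by rewrite addrA subrK.
move=> nlb; exists l; first by rewrite inE ls orbT.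
move=> a; rewrite inE => /orP[/eqP -> bl|]; last exact: hl.
have [|h|h] := @pos_total (l - b); first by rewrite subr_eq0 eq_sym.
  exact: h.
by case: nlb; rewrite /lower -opprB.
Qed.

(** The top coefficient of the leading term of [exp (t D) x] lies in the limit, hence in [U]. As [U]
    is stable and inside [X], that coefficient can be subtracted without leaving what [X] realizes,
    and the degree drops. So the component of [x] of largest eigenvalue is in [U], and removing it
    leaves fewer eigenvalues. *)
Lemma limit_reflects G X U : is_subspace G -> stable D G -> is_subspace X ->
  is_subspace U -> stable D U -> subset_of U X -> subset_of X G ->
  (forall x, X x -> exists s, kills D s x) ->
  subset_of (limit G X) U -> subset_of X U.
Proof.
move=> hG sG hX hU sU UX XG hk limU.
have poly_in_U e l p : (forall k, G (p k) /\ geig (eq l) (p k)) ->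
    (forall k, (e <= k)%N -> p k = 0) -> realizes X l p -> forall k, U (p k).
  elim: e p => [|e IH] p hp pe pX k; first by rewrite pe //; exact: subspace0.
  have Ue : U (p e).
    by apply: limU; apply: mem_span; exists l, e, p; split.
  pose top k := if k == e then p e else 0.
  have topU j : U (top j) by rewrite /top; case: eqP => // _; exact: subspace0.
  pose r j := p j + (-1) *: top j.
  have rE j : r j = if j == e then 0 else p j.
    rewrite /r /top scaleN1r; case: eqP => [->|_]; first by rewrite subrr.
    by rewrite oppr0 addr0.
  have Ur : U (r k).
    apply: IH.
    - move=> j; rewrite rE; case: eqP => // _.
      by split; [exact: subspace0 | exact: (subspace0 (geig_subspace Dlin _))].
    - move=> j; rewrite rE leq_eqVlt eq_sym => /orP[->//|ej].
      by rewrite (pe j ej) if_same.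
    - apply: realizes_add => //; apply: realizes_scale => //.
      exact: realizes_stable hU sU UX topU.
  move: Ur; rewrite rE; case: eqP => // -> _; exact: Ue.
move=> x Xx; have [s] := hk x Xx.
have [n] := ubnP (size s); elim: n s x Xx => // n IH s x Xx hn hs.
have [s0|s0] := eqVneq s [::].
  by move: hs; rewrite s0 /kills /= => ->; exact: subspace0.
have [l ls hl] := max_weight s0.
have [x1 [x2 [xE k1 k2 xY]]] := kills_split Dlin (pred1 l) hs.
have [G1 G2] := xY G hG sG (XG _ Xx).
have [d xd] := geig_eq_nseq k1.
have hx1 : geig (eq l) x1.
  by exists [seq b <- s | pred1 l b] => // b; rewrite mem_filter => /andP[/eqP].
have U1 : U x1.
  (* These are the coefficients of [exp (t (D - l)) x1]. [delta l] annihilates this sequence, so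
     only the constant coefficient needs a nonzero witness, namely [x]. *)
  apply: (poly_in_U d l (fun k => iter k (T l) x1) _ _ _ 0%N).
  - elim=> [|k [Gk gk]] //=; split; last exact: geig_shift.
    exact: stable_shift.
  - move=> k dk; rewrite -(subnK dk) iterD xd.
    by elim: (k - d)%N => //= j ->; exact: shift_op0.
  - have d0 : delta l (fun k => iter k (T l) x1) = fun _ => 0.
      by apply/funext => k; rewrite /delta /= subrr.
    move=> [|k].
      exists x; split=> //=; rewrite xE addrC addKr.
      exists [seq b <- s | ~~ pred1 l b] => // b.
      by rewrite mem_filter => /andP[bl bs]; exact: hl.
    exists 0; split; first exact: subspace0.
    rewrite iterSr d0 sub0r; have -> : iter k (delta l) (fun _ => 0) 0%N = 0.
      suff -> : iter k (delta l) (fun _ => 0) = fun _ => 0 by [].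
      elim: k => //= k ->; apply/funext => j.
      by rewrite /delta shift_op0 // subr0.
    by rewrite oppr0; exact: (subspace0 (geig_subspace Dlin _)).
rewrite xE; apply: subspaceD => //; apply: IH k2.
  have -> : x2 = x - x1 by rewrite xE addrC addKr.
  by apply: subspaceB => //; exact: UX.
rewrite size_filter -ltnS; apply: leq_trans hn; rewrite ltnS.
rewrite -(count_predC (pred1 l) s) -[X in (X < _)%N]add0n ltn_add2r.
by rewrite -has_count; apply/hasP; exists l => //=.
Qed.

End Degeneration.

(** * Locally solvable subalgebras *)

Section Exhaustion.
Variables (F : fieldType) (L : lmodType F) (br : L -> L -> L).
Hypothesis hbr : is_lie_bracket br.
Variable g : nat -> L -> Prop.
Hypothesis g_alg : forall n, is_subalgebra br (g n).
Hypothesis g_fin : forall n, fin_dim (g n).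
Hypothesis g_succ : forall n, subset_of (g n) (g n.+1).
Hypothesis g_cover : forall x, exists n, g n x.
Implicit Types (S X Y U : L -> Prop).

Definition ideal S := is_subspace S /\ forall x y, S y -> S (br x y).

Definition centralizes S z := forall y, S y -> br z y = 0.

Lemma level_subspace n : is_subspace (g n). Proof. by case: (g_alg n). Qed.

Lemma level_lie n x y : g n x -> g n y -> g n (br x y).
Proof. by case: (g_alg n) => _; apply. Qed.

Lemma level_mono m n : (m <= n)%N -> subset_of (g m) (g n).
Proof.
move=> mn; rewrite -(subnK mn); elim: (n - m)%N => // k IH x /IH.
by rewrite addSn; exact: g_succ.
Qed.

Lemma common_level (T : eqType) (P : nat -> T -> Prop) (s : seq T) :
  (forall m n, (m <= n)%N -> forall x, P m x -> P n x) ->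
  (forall x, x \in s -> exists n, P n x) -> exists n, forall x, x \in s -> P n x.
Proof.
move=> Pmono; elim: s => [|x s IH] hs; first by exists 0%N.
have [n hn] : exists n, forall x, x \in s -> P n x.
  by apply: IH => y ys; apply: hs; rewrite inE ys orbT.
have [m hm] : exists n, P n x by apply: hs; rewrite inE eqxx.
exists (maxn m n) => y; rewrite inE => /orP[/eqP ->|/hn].
  exact: Pmono (leq_maxl _ _) _ hm.
exact: Pmono (leq_maxr _ _) _.
Qed.

Lemma derived_mono X Y : subset_of X Y -> subset_of (derived br X) (derived br Y).
Proof.
move=> XY; apply: span_mono => z [x [y [Xx Xy ->]]].
by exists x, y; split=> //; exact: XY.
Qed.

Lemma iter_derived_mono n X Y : subset_of X Y ->
  subset_of (iter n (derived br) X) (iter n (derived br) Y).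
Proof. by move=> XY; elim: n => //= n; exact: derived_mono. Qed.

Lemma derived_sub X : is_subalgebra br X -> subset_of (derived br X) X.
Proof.
move=> [hX XX]; apply: span_sub => // z [x [y [Xx Xy ->]]]; exact: XX.
Qed.

Lemma solvable_sub X Y : subset_of X Y -> solvable_alg br Y -> solvable_alg br X.
Proof.
move=> XY [n hn]; exists n => v hv; apply: hn; exact: iter_derived_mono hv.
Qed.

Lemma subalgebraI X Y : is_subalgebra br X -> is_subalgebra br Y ->
  is_subalgebra br (fun v => X v /\ Y v).
Proof.
move=> [hX XX] [hY YY]; split; first exact: subspaceI.
by move=> x y [? ?] [? ?]; split; [exact: XX | exact: YY].
Qed.

Lemma ideal_subalgebra S : ideal S -> is_subalgebra br S.
Proof. by move=> [hS SS]; split=> // x y _; exact: SS. Qed.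

Lemma locally_solvable_fin S X : locally_solvable br S -> fin_dim X ->
  subset_of X S -> solvable_alg br X.
Proof.
move=> lS [t ht] XS; have [|T [[hT _] _ _ sT tT]] := lS t.
  by move=> x xt; apply: XS; apply/ht; exact: mem_span.
apply: solvable_sub sT => v /ht; exact: span_sub.
Qed.

Lemma locally_solvable_sub S X : locally_solvable br S -> is_subalgebra br X ->
  subset_of X S -> locally_solvable br X.
Proof.
move=> lS aX XS s hs; have [|T [aT TS fT sT tT]] := lS s.
  by move=> x /hs /XS.
exists (fun v => T v /\ X v); split.
- exact: subalgebraI.
- by move=> v [].
- apply: fin_dim_sub fT _ _; last by move=> v [].
  by apply: subspaceI; [case: aT | case: aX].
- by apply: solvable_sub sT => v [].
- by move=> x xs; split; [exact: tT | exact: hs].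
Qed.

Lemma fin_dim_level X m : is_subspace X -> fin_dim (fun v => X v /\ g m v).
Proof.
move=> hX; apply: fin_dim_sub (g_fin m) _ _; last by move=> v [].
by apply: subspaceI => //; exact: level_subspace.
Qed.

Lemma locally_solvable_levels X : is_subalgebra br X ->
  (forall m, solvable_alg br (fun v => X v /\ g m v)) -> locally_solvable br X.
Proof.
move=> aX hX s hs; have [|m hm] := common_level level_mono (s := s).
  by move=> x _; exact: g_cover.
exists (fun v => X v /\ g m v); split=> //.
- exact: subalgebraI.
- by move=> v [].
- by apply: fin_dim_level; case: aX.
- by move=> x xs; split; [exact: hs | exact: hm].
Qed.

Lemma solvable_add X Y : is_subalgebra br X -> is_subspace Y ->
  (forall y y', Y y -> Y y' -> Y (br y y')) ->
  (forall x y, X x -> Y y -> Y (br x y)) ->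
  solvable_alg br X -> solvable_alg br Y ->
  solvable_alg br (fun v => exists x y, [/\ X x, Y y & v = x + y]).
Proof.
move=> aX hY YY XY [n hn] [k hk]; exists (k + n)%N => v.
rewrite iterD => hv; apply: hk; apply: iter_derived_mono hv => {}v.
have h j : subset_of (iter j (derived br) (fun v => exists x y, [/\ X x, Y y & v = x + y]))
    (fun v => exists x y, [/\ iter j (derived br) X x, Y y & v = x + y]).
  elim: j => //= j IH; apply: span_sub.
    by apply: subspace_add => //; exact: span_subspace.
  move=> _ [_ [_ [/IH[x [y [Xx Yy ->]]] /IH[x' [y' [Xx' Yy' ->]]] ->]]].
  have iX : subset_of (iter j (derived br) X) X.
    elim: {IH x x' Xx Xx'} j => //= j IH u.
    by move=> /(derived_mono IH); exact: derived_sub.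
  exists (br x x'), (br x y' + br y x' + br y y'); split.
  - by apply: mem_span; exists x, x'.
  - apply: subspaceD => //; last exact: YY.
    apply: subspaceD => //; first by apply: XY => //; exact: iX.
    by rewrite (lieC hbr); apply: subspaceN => //; apply: XY => //; exact: iX.
  - by rewrite (lieDl hbr) !(lieDr hbr) !addrA.
by move/h => [x [y [/hn -> Yy ->]]]; rewrite add0r.
Qed.

Lemma locally_solvable_add X Y : is_subalgebra br X -> is_subalgebra br Y ->
  (forall x y, X x -> Y y -> Y (br x y)) ->
  locally_solvable br X -> locally_solvable br Y ->
  is_subalgebra br (fun v => exists x y, [/\ X x, Y y & v = x + y]) /\
  locally_solvable br (fun v => exists x y, [/\ X x, Y y & v = x + y]).
Proof.
move=> aX aY XY lX lY.
have hadd X' Y' : is_subalgebra br X' -> is_subalgebra br Y' ->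
    (forall x y, X' x -> Y' y -> Y' (br x y)) ->
    is_subalgebra br (fun v => exists x y, [/\ X' x, Y' y & v = x + y]).
  move=> [hX' XX'] [hY' YY'] XY'; split; first exact: subspace_add.
  move=> _ _ [x [y [Xx Yy ->]]] [x' [y' [Xx' Yy' ->]]].
  exists (br x x'), (br x y' + br y x' + br y y'); split; first exact: XX'.
    apply: subspaceD => //; last exact: YY'.
    apply: subspaceD => //; first exact: XY'.
    by rewrite (lieC hbr); apply: subspaceN => //; exact: XY'.
  by rewrite (lieDl hbr) !(lieDr hbr) !addrA.
split; first exact: hadd.
move=> s hs.
(* Both summands are kept at level [m], which may be smaller than intersecting the sum with [g m],
   so that [solvable_add] applies to two solvable finite-dimensional pieces. *)
pose lev m v := exists x y, [/\ X x /\ g m x, Y y /\ g m y & v = x + y].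
have [||m hm] := @common_level _ lev s.
- move=> i j ij v [x [y [[Xx gx] [Yy gy] ->]]]; exists x, y.
  by split=> //; split=> //; exact: (level_mono ij).
- move=> v /hs[x [y [Xx Yy ->]]].
  have [i gx] := g_cover x; have [j gy] := g_cover y.
  exists (maxn i j), x, y; split=> //; split=> //.
    exact: (level_mono (leq_maxl _ _)).
  exact: (level_mono (leq_maxr _ _)).
have aXm := subalgebraI aX (g_alg m); have aYm := subalgebraI aY (g_alg m).
have XYm x y : X x /\ g m x -> Y y /\ g m y -> Y (br x y) /\ g m (br x y).
  by move=> [? ?] [? ?]; split; [exact: XY | exact: level_lie].
have fX : fin_dim (fun v => X v /\ g m v) by apply: fin_dim_level; case: aX.
have fY : fin_dim (fun v => Y v /\ g m v) by apply: fin_dim_level; case: aY.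
exists (lev m); split=> //.
- exact: hadd.
- by move=> v [x [y [[? _] [? _] ->]]]; exists x, y.
- exact: fin_dim_add.
- apply: solvable_add => //; [by case: aYm | by case: aYm | |].
    by apply: locally_solvable_fin lX fX _ => v [].
  by apply: locally_solvable_fin lY fY _ => v [].
Qed.

(** * Consequences of the maximality of the Borel subalgebra *)

Variable b : L -> Prop.
Hypothesis hb : is_Borel br (fun _ => True) b.

Lemma borel_subalgebra : is_subalgebra br b. Proof. by case: hb. Qed.

(** [b + Y] is a locally solvable subalgebra containing [b]. All uses of maximality of [b] pass
    through here. *)
Lemma borel_absorbs Y : is_subalgebra br Y -> locally_solvable br Y ->
  (forall x y, b x -> Y y -> Y (br x y)) -> subset_of Y b.
Proof.
move=> aY lY bY; case: hb => ab _ lb maxb.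
have [aS lS] := locally_solvable_add ab aY bY lb lY.
move=> y Yy; apply: (maxb _ aS _ lS) => //.
  move=> x bx; exists x, 0; rewrite addr0; split=> //.
  by apply: subspace0; case: aY.
by exists 0, y; rewrite add0r; split=> //; apply: subspace0; case: ab.
Qed.

Section Ideal.
Variable S : L -> Prop.
Hypothesis hS : ideal S.

Lemma centralizes_ideal : ideal (centralizes S).
Proof.
split; first split.
- by move=> y _; exact: lie0l.
- by move=> x x' hx hx' y Sy; rewrite (lieDl hbr) hx // hx' // addr0.
- by move=> a x hx y Sy; rewrite (lieZl hbr) hx // scaler0.
move=> x z hz y Sy; have Sxy : S (br x y) by case: hS => _; apply.
have := lie_jacobi hbr x z y; rewrite (hz _ Sy) (hz _ Sxy) (lie0r hbr) addr0.
by move=> <-.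
Qed.

(** The elements of [S] that act on [S] as some element of [b] form a subalgebra [U] normalized by
    [b]. Its derived series is shadowed by that of [b], which makes [U] locally solvable, so [b]
    absorbs it. *)
Lemma borel_inner x u : b x -> S u -> centralizes S (x - u) -> b u.
Proof.
move=> bx Su xu.
have [hC CC] := centralizes_ideal; have [hS0 SS] := hS.
have [hb0 bb] := borel_subalgebra.
pose U u := S u /\ exists x, b x /\ centralizes S (x - u).
have hU : is_subspace U.
  split.
  - split; first exact: subspace0.
    by exists 0; split; [exact: subspace0 | rewrite subr0; exact: subspace0].
  - move=> v v' [Sv [y [Sy yv]]] [Sv' [y' [Sy' yv']]]; split; first exact: subspaceD.
    exists (y + y'); split; first exact: subspaceD.
    by rewrite opprD addrACA; apply: (subspaceD hC).
  - move=> a v [Sv [y [Sy yv]]]; split; first exact: subspaceZ.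
    exists (a *: y); split; first exact: subspaceZ.
    by rewrite -scalerBr; apply: (subspaceZ _ hC).
have bU y v : b y -> U v -> U (br y v).
  move=> By [Sv [z [Bz zv]]]; split; first exact: SS.
  by exists (br y z); split; [exact: bb | rewrite -(lieBr hbr); exact: CC].
have lieU x1 x2 u1 u2 : S u1 -> centralizes S (x1 - u1) ->
    centralizes S (x2 - u2) -> centralizes S (br x1 x2 - br u1 u2).
  move=> Su1 xu1 xu2; have -> : br x1 x2 - br u1 u2 =
      - br x2 (x1 - u1) - br (x2 - u2) u1.
    rewrite (lieBr hbr) (lieBl hbr) (lieC hbr u1 u2) (lieC hbr x1 x2).
    by rewrite !opprB opprK [RHS]addrC addrA subrK addrC.
  rewrite (xu2 _ Su1) subr0; apply: (subspaceN hC); exact: CC.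
have aU : is_subalgebra br U.
  split=> // u1 u2 [Su1 [x1 [bx1 xu1]]] [Su2 [x2 [bx2 xu2]]]; split; first exact: SS.
  by exists (br x1 x2); split; [exact: bb | exact: lieU].
have lU : locally_solvable br U.
  apply: locally_solvable_levels => // m.
  have [t ht] := fin_dim_level m hU.
  (* The partners in [b] of elements of [g m] may live at a higher level [k]; finitely many
     generators of [U] at level [m] make one [k] suffice. *)
  pose P k v := S v /\ exists y, (b y /\ g k y) /\ centralizes S (y - v).
  have P_subspace k : is_subspace (P k).
    split.
    - split; first exact: subspace0.
      exists 0; split; last by rewrite subr0; exact: subspace0.
      by split; [exact: subspace0 | exact: (subspace0 (level_subspace k))].
    - move=> v v' [Sv [y [[By gy] yv]]] [Sv' [y' [[By' gy'] yv']]].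
      split; first exact: subspaceD.
      exists (y + y'); split; last by rewrite opprD addrACA; apply: (subspaceD hC).
      by split; [exact: subspaceD | exact: (subspaceD (level_subspace k))].
    - move=> a v [Sv [y [[By gy] yv]]]; split; first exact: subspaceZ.
      exists (a *: y); split; last by rewrite -scalerBr; apply: (subspaceZ _ hC).
      by split; [exact: subspaceZ | exact: (subspaceZ _ (level_subspace k))].
  have [||k hk] := @common_level _ P t.
  - move=> i j ij v [Sv [y [[By gy] yv]]]; split=> //; exists y.
    by split=> //; split=> //; exact: (level_mono ij).
  - move=> v vt; have [[Sv [y [By yv]]] _] := (ht v).2 (mem_span vt).
    by have [k gk] := g_cover y; exists k; split=> //; exists y.
  have solv : solvable_alg br (fun v => b v /\ g k v).
    apply: (locally_solvable_fin (S := b)); [by case: hb | exact: fin_dim_level |].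
    by move=> v [].
  have [n hn] := solv.
  have shadow j : subset_of (iter j (derived br) (fun v => U v /\ g m v))
      (fun v => S v /\ exists y, iter j (derived br) (fun v => b v /\ g k v) y /\
                                 centralizes S (y - v)).
    elim: j => [|j IH] /=.
      by move=> v /ht hv; apply: (span_sub (P_subspace k)) hv => y; exact: hk.
    apply: span_sub.
      have hD := span_subspace (fun z : L => exists x y, [/\
        iter j (derived br) (fun v => b v /\ g k v) x,
        iter j (derived br) (fun v => b v /\ g k v) y & z = br x y]).
      split.
      + split; first exact: subspace0.
        by exists 0; split; [exact: (subspace0 hD) | rewrite subr0; exact: subspace0].
      + move=> v v' [Sv [y [Dy yv]]] [Sv' [y' [Dy' yv']]].
        split; first exact: subspaceD.
        exists (y + y'); split; first exact: (subspaceD hD).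
        by rewrite opprD addrACA; apply: (subspaceD hC).
      + move=> a v [Sv [y [Dy yv]]]; split; first exact: subspaceZ.
        exists (a *: y); split; first exact: (subspaceZ _ hD).
        by rewrite -scalerBr; apply: (subspaceZ _ hC).
    move=> _ [u1 [u2 [/IH[Su1 [x1 [bx1 xu1]]] /IH[Su2 [x2 [bx2 xu2]]] ->]]].
    split; first exact: SS.
    exists (br x1 x2); split; last exact: lieU.
    by apply: mem_span; exists x1, x2.
  (* After [n] steps the partner in [b] is 0, so the elements centralize [S]; being in [S]
     themselves, they commute, which costs one more step. *)
  exists n.+1 => /=; apply: span_sub.
    by split=> // [x1 x2 -> ->|a x1 ->]; rewrite ?addr0 ?scaler0.
  move=> _ [u1 [u2 [/shadow[Su1 [x1 [/hn -> xu1]]] /shadow[Su2 _] ->]]].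
  by have := xu1 _ Su2; rewrite sub0r (lieNl hbr) => /eqP; rewrite oppr_eq0 => /eqP.
by apply: (borel_absorbs aU lU bU); split=> //; exists x.
Qed.

End Ideal.
End Exhaustion.

(** * Making a locally solvable algebra stable under the Borel subalgebra *)

Section StableExtension.
Variables (F : closedFieldType) (L : lmodType F) (br : L -> L -> L).
Hypothesis char0 : forall n, n.+1%:R != 0 :> F.
Hypothesis hbr : is_lie_bracket br.
Variable g : nat -> L -> Prop.
Hypothesis g_alg : forall n, is_subalgebra br (g n).
Hypothesis g_fin : forall n, fin_dim (g n).
Hypothesis g_succ : forall n, subset_of (g n) (g n.+1).
Hypothesis g_cover : forall x, exists n, g n x.
Variable b : L -> Prop.
Hypothesis hb : is_Borel br (fun _ => True) b.
Variable S : L -> Prop.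
Hypothesis hS : ideal br S.

(** Induction on the directions [xs] missing from [h]: a limit along [ad x] moves [x] into the
    normalizing space. That [h] contains [[b, b]] makes [h] stable under [ad x], so the directions
    already gained survive the limit. *)
Lemma stable_extension (xs : seq L) (h X : L -> Prop) :
  is_subspace h -> subset_of h b -> (forall x y, b x -> b y -> h (br x y)) ->
  (forall x, x \in xs -> b x) ->
  (forall y, b y -> exists z, h z /\ span (fun x => x \in xs) (y - z)) ->
  is_subalgebra br X -> subset_of X S -> locally_solvable br X ->
  (forall u, b u -> S u -> X u) -> (forall y v, h y -> X v -> X (br y v)) ->
  subset_of X b.
Proof.
have [pos [pos_cone pos_total]] : exists P : F -> Prop,
    positive_cone P /\ forall x, x != 0 -> P x \/ P (- x).
  apply: total_cone => x n x0; rewrite -mulr_natr mulf_eq0 negb_or x0.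
  exact: char0.
have [hS0 SS] := hS; have [hb0 bb] := borel_subalgebra hb.
elim: xs h X => [|x xs IH] h X hh hbs bbh xsb hspan aX XS lX UX hX.
  apply: (borel_absorbs hbr g_alg g_fin g_succ g_cover hb) aX lX _ => y v By Xv.
  apply: hX => //.
  have [z [hz]] := hspan y By.
  have null : subset_of (span (fun x : L => x \in [::])) (fun v => v = 0).
    apply: span_sub => //.
    by split=> // [u w -> ->|a u ->]; rewrite ?addr0 ?scaler0.
  by move/null/eqP; rewrite subr_eq0 => /eqP ->.
have bx : b x by apply: xsb; rewrite inE eqxx.
have [m0 gx] := g_cover x.
pose D := br x.
have Dlin : linear D := lie_linearr hbr x.
have Dder u v : D (br u v) = br (D u) v + br u (D v) := lie_jacobi hbr x u v.
have [hX0 XX] := aX.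
pose G m v := g m v /\ S v.
pose Xm m v := X v /\ g m v.
(* From level [m0] on, [x] lies in [g m], so [ad x] preserves [g m]; the limits increase with [m]
   and [X2] is their union. *)
pose X2 v := exists m, (m0 <= m)%N /\ limit D pos (G m) (Xm m) v.
have hG m : is_subspace (G m) by apply: subspaceI => //; exact: (level_subspace g_alg).
have hXm m : is_subspace (Xm m) by apply: subspaceI => //; exact: (level_subspace g_alg).
have sg m : (m0 <= m)%N -> stable D (g m).
  by move=> mm v gv; apply: (level_lie g_alg) => //; exact: (level_mono g_succ mm gx).
have sG m : (m0 <= m)%N -> stable D (G m).
  by move=> mm v [gv Sv]; split; [exact: sg | exact: SS].
have kg m v : (m0 <= m)%N -> g m v -> exists s, kills D s v.
  by move=> mm gv; apply: fin_dim_kills gv => //; exact: sg.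
have lim_mono i j : (i <= j)%N ->
    subset_of (limit D pos (G i) (Xm i)) (limit D pos (G j) (Xm j)).
  move=> ij; apply: limit_mono => v [v1 v2]; split=> //; exact: (level_mono g_succ ij).
have lim_sub m := limit_sub (D := D) (pos := pos) (X := Xm m) (hG m).
have join u v : X2 u -> X2 v -> exists m, [/\ (m0 <= m)%N,
    limit D pos (G m) (Xm m) u & limit D pos (G m) (Xm m) v].
  move=> [i [mi hu]] [j [mj hv]]; exists (maxn i j); split.
  - exact: leq_trans mi (leq_maxl _ _).
  - exact: lim_mono (leq_maxl _ _) _ hu.
  - exact: lim_mono (leq_maxr _ _) _ hv.
have hX2 : is_subspace X2.
  split.
  - by exists m0; split=> //; exact: (subspace0 (span_subspace _)).
  - move=> u v Xu Xv; have [m [mm hu hv]] := join u v Xu Xv.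
    by exists m; split=> //; exact: (subspaceD (span_subspace _)).
  - move=> a u [m [mm hu]].
    by exists m; split=> //; exact: (subspaceZ _ (span_subspace _)).
have GG m u v : G m u -> G m v -> G m (br u v).
  by move=> [gu Su] [gv Sv]; split; [exact: (level_lie g_alg) | exact: SS].
have aX2 : is_subalgebra br X2.
  split=> // u v Xu Xv; have [m [mm hu hv]] := join u v Xu Xv.
  exists m; split=> //.
  apply: (limit_lie hbr Dlin Dder pos_cone char0 (hG m) (hXm m) (@GG m) _ hu hv).
  by move=> y z [Xy gy] [Xz gz]; split; [exact: XX | exact: (level_lie g_alg)].
have lX2 : locally_solvable br X2.
  apply: (locally_solvable_levels g_alg g_fin g_succ g_cover) => // k.
  have [t ht] := fin_dim_level g_alg g_fin k hX2.
  have [v vt|m hm] := @common_level _ (fun m => limit D pos (G m) (Xm m)) t lim_mono.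
    by have [[m [_ hv]] _] := (ht v).2 (mem_span vt); exists m.
  have sX : solvable_alg br (Xm m).
    by apply: locally_solvable_fin lX (fin_dim_level g_alg g_fin m hX0) _ => v [].
  have [n hn] := sX; apply: (@solvable_sub _ _ br _ (limit D pos (G m) (Xm m))).
    by move=> v /ht; apply: span_sub; first exact: span_subspace.
  exists n => v /(iter_derived_limit hbr Dlin Dder pos_cone char0 (hG m) (@GG m)).
  exact: limit0.
have hU0 : is_subspace (fun v => b v /\ S v) by exact: subspaceI.
pose Um m v := (b v /\ S v) /\ g m v.
have hUm m : is_subspace (Um m) by apply: subspaceI => //; exact: (level_subspace g_alg).
have sUm m : (m0 <= m)%N -> stable D (Um m).
  move=> mm v [[bv Sv] gv]; split; last exact: sg.
  by split; [exact: bb | exact: SS].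
have level v : exists m, (m0 <= m)%N /\ g m v.
  have [m gv] := g_cover v; exists (maxn m0 m); split; first exact: leq_maxl.
  exact: (level_mono g_succ (leq_maxr _ _) gv).
pose h' v := exists z w, [/\ h z, exists c, w = c *: x & v = z + w].
have X2b : subset_of X2 b.
  apply: (IH h') => //.
  - apply: subspace_add => //; split.
    + by exists 0; rewrite scale0r.
    + by move=> _ _ [c ->] [c' ->]; exists (c + c'); rewrite scalerDl.
    + by move=> a _ [c ->]; exists (a * c); rewrite scalerA.
  - move=> _ [z [_ [hz [c ->] ->]]]; apply: subspaceD => //; first exact: hbs.
    exact: subspaceZ.
  - move=> y z By Bz; exists (br y z), 0; split; [exact: bbh | | by rewrite addr0].
    by exists 0; rewrite scale0r.
  - by move=> y yxs; apply: xsb; rewrite inE yxs orbT.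
  - move=> y By; have [z [hz /span_cons[c [w [hw yE]]]]] := hspan y By.
    exists (z + c *: x); split; first by exists z, (c *: x); split=> //; exists c.
    by rewrite opprD addrA yE addrAC subrr add0r.
  - by move=> v [m [_ /lim_sub[]]].
  - move=> u Bu Su; have [m [mm gu]] := level u; exists m; split=> //.
    apply: (@limit_mono _ _ D pos (G m) (G m) (Um m)) => //.
      by move=> v [[Bv Sv] gv]; split=> //; exact: UX.
    apply: (stable_sub_limit Dlin) => //; first exact: sUm.
      by move=> v [[Bv Sv] gv].
    by move=> v [_ gv]; exact: kg gv.
  move=> _ v [z [_ [hz [c ->] ->]]] Xv; rewrite (lieDl hbr) (lieZl hbr).
  apply: subspaceD => //; last first.
    apply: subspaceZ => //; have [m [mm hv]] := Xv; exists m; split=> //.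
    by apply: (limit_D Dlin) hv => //; exact: sG.
  have [i [mi gz]] := level z; have [j [mj hv]] := Xv.
  pose m := maxn i j; have mm : (m0 <= m)%N by apply: leq_trans mi (leq_maxl _ _).
  exists m; split=> //.
  pose hm v := h v /\ g m v.
  have hv' := lim_mono _ _ (leq_maxr i j) _ hv.
  have gz' := level_mono g_succ (leq_maxl i j) gz.
  have hhm : is_subspace hm by apply: subspaceI => //; exact: (level_subspace g_alg).
  (* [z] is in the limit of a space normalizing [X], so bracketing with it maps the limit of [X] to
     itself. *)
  have hz' : limit D pos (g m) hm z.
    suff sub : subset_of hm (limit D pos (g m) hm) by exact: sub.
    apply: (stable_sub_limit Dlin pos hhm).
    - move=> w [hw gw]; split; last exact: sg.
      by apply: bbh => //; exact: hbs.
    - by move=> w [].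
    - by move=> w [_ gw]; exact: kg gw.
  apply: (limit_lie hbr Dlin Dder pos_cone char0 (hG m) (hXm m) _ _ hz' hv').
  - by move=> u w gu [gw Sw]; split; [exact: (level_lie g_alg) | exact: SS].
  - by move=> u w [hu gu] [Xw gw]; split; [exact: hX | exact: (level_lie g_alg)].
move=> v Xv; have [m [mm gv]] := level v.
(* [Um m] is stable under [ad x] and contains the limit at level [m], because [X2] lies in [b]; so
   [limit_reflects] applies. *)
suff : Um m v by case=> -[].
apply: (limit_reflects Dlin pos_cone pos_total (hG m) (sG m mm) (hXm m) (hUm m) (sUm m mm)).
- by move=> u [[Bu Su] gu]; split=> //; exact: UX.
- by move=> u [Xu gu]; split=> //; exact: XS.
- by move=> u [_ gu]; exact: kg gu.
- move=> u hu; have [gu Su] := lim_sub _ _ hu.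
  by split=> //; split=> //; apply: X2b; exists m.
- by [].
Qed.

End StableExtension.

(** * Finitely many outer directions *)

Section Structure.
Variables (F : fieldType) (L : lmodType F) (br : L -> L -> L).
Hypothesis hbr : is_lie_bracket br.
Variable g : nat -> L -> Prop.
Hypothesis g_alg : forall n, is_subalgebra br (g n).
Hypothesis g_succ : forall n, subset_of (g n) (g n.+1).
Hypothesis g_cover : forall x, exists n, g n x.
Hypothesis g_red : forall n, reductive br (g n).
Hypothesis g_red_in : forall n, reductive_in br (g n) (g n.+1).
Variables (V : lmodType F) (rho : L -> V -> V).
Hypothesis rho_linl : forall (a : F) x y v, rho (a *: x + y) v = a *: rho x v + rho y v.
Hypothesis rho_linr : forall x, linear (rho x).
Hypothesis rho_br : forall x y v,
  rho (br x y) v = rho x (rho y v) - rho y (rho x v).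
Hypothesis rho_faithful : forall x, (forall v, rho x v = 0) -> x = 0.
Hypothesis rho_fin : forall x, exists s : seq V, forall v,
  span (fun w => w \in s) (rho x v).
Variables (c : L) (k : nat).
Hypothesis hc : derived br (g k) c.

Lemma rhoDl x y v : rho (x + y) v = rho x v + rho y v.
Proof. by have := rho_linl 1 x y v; rewrite !scale1r. Qed.
Lemma rho0l v : rho 0 v = 0.
Proof. by apply: (addrI (rho 0 v)); rewrite -rhoDl !addr0. Qed.
Lemma rhoZl a x v : rho (a *: x) v = a *: rho x v.
Proof. by have := rho_linl a x 0 v; rewrite rho0l !addr0. Qed.
Lemma rhoNl x v : rho (- x) v = - rho x v.
Proof. by rewrite -scaleN1r rhoZl scaleN1r. Qed.
Lemma rhoBl x y v : rho (x - y) v = rho x v - rho y v.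
Proof. by rewrite rhoDl rhoNl. Qed.
Lemma rho_suml (I : Type) (r : seq I) (G : I -> L) v :
  rho (\sum_(i <- r) G i) v = \sum_(i <- r) rho (G i) v.
Proof. by elim/big_rec2: _ => [|i y x _ <-]; rewrite ?rho0l ?rhoDl. Qed.
Lemma rhoDr x u v : rho x (u + v) = rho x u + rho x v.
Proof. exact: (linop_add (rho_linr x)). Qed.
Lemma rho0r x : rho x 0 = 0.
Proof. exact: (linop0 (rho_linr x)). Qed.
Lemma rhoZr x a v : rho x (a *: v) = a *: rho x v.
Proof. exact: (linop_scale (rho_linr x)). Qed.
Lemma rhoNr x v : rho x (- v) = - rho x v.
Proof. exact: (linop_opp (rho_linr x)). Qed.
Lemma rhoBr x u v : rho x (u - v) = rho x u - rho x v.
Proof. by rewrite rhoDr rhoNr. Qed.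

Lemma rho_kernel (X : V -> Prop) x :
  (forall v, X v -> rho x v = 0) -> forall v, span X v -> rho x v = 0.
Proof.
move=> hX; apply: span_sub => //.
by split=> [|u v hu hv|a u hu]; rewrite ?rho0r ?rhoDr ?rhoZr ?hu ?hv ?addr0 ?scaler0.
Qed.

Lemma rho_commute x y v : br x y = 0 -> rho x (rho y v) = rho y (rho x v).
Proof.
by move=> xy; apply/eqP; rewrite -subr_eq0 -rho_br xy rho0l.
Qed.

Let gS n : is_subspace (g n).
Proof. exact: (level_subspace g_alg). Qed.
Let gle n x y : g n x -> g n y -> g n (br x y).
Proof. exact: (level_lie g_alg). Qed.
Let gmono m n : (m <= n)%N -> subset_of (g m) (g n).
Proof. exact: (level_mono g_succ). Qed.

(** Encoded as an intersection, so that membership is itself the induction principle for the ideal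
    generated by [c]. *)
Definition level_ideal m (v : L) : Prop := forall I, is_subspace I -> I c ->
  (forall x y, g m x -> I y -> I (br x y)) -> I v.
Local Notation J := level_ideal.

Lemma level_ideal_subspace m : is_subspace (J m).
Proof.
split.
- by move=> I hI _ _; exact: subspace0.
- by move=> x y hx hy I hI Ic gI; apply: subspaceD => //; [exact: hx | exact: hy].
- by move=> a x hx I hI Ic gI; apply: subspaceZ => //; exact: hx.
Qed.

Lemma level_ideal_gen m : J m c. Proof. by []. Qed.

Lemma level_ideal_lie m x y : g m x -> J m y -> J m (br x y).
Proof. by move=> gx Jy I hI Ic gI; exact: gI gx (Jy I hI Ic gI). Qed.

Lemma level_gen m : (k <= m)%N -> g m c.
Proof. by move=> km; exact: gmono km _ (derived_sub (g_alg k) hc). Qed.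

Lemma level_ideal_sub m : (k <= m)%N -> subset_of (J m) (g m).
Proof. by move=> km v; apply; [exact: gS | exact: level_gen | exact: gle]. Qed.

Lemma level_ideal_mono m n : (m <= n)%N -> subset_of (J m) (J n).
Proof.
move=> mn v; apply; [exact: level_ideal_subspace | exact: level_ideal_gen |].
by move=> x y gx; apply: level_ideal_lie; exact: (gmono mn gx).
Qed.

Lemma disjoint_commute m I I' x y :
  (forall x y, g m x -> I y -> I (br x y)) ->
  (forall x y, g m x -> I' y -> I' (br x y)) -> is_subspace I ->
  subset_of I (g m) -> subset_of I' (g m) ->
  (forall v, I v -> I' v -> v = 0) -> I x -> I' y -> br x y = 0.
Proof.
move=> gI gI' hI Ig I'g disj Ix Iy; apply: disj; last by apply: gI' => //; exact: Ig.
by rewrite (lieC hbr); apply: subspaceN => //; apply: gI => //; exact: I'g.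
Qed.

(** Reductivity gives [J m] a complementary ideal, and ideals meeting in 0 commute. *)
Lemma level_split m x : (k <= m)%N -> g m x ->
  exists2 j, J m j & forall y, J m y -> br (x - j) y = 0.
Proof.
move=> km gx.
have [K [hK Kg gK disj dec]] :=
  g_red (level_ideal_subspace m) (level_ideal_sub km) (@level_ideal_lie m).
have [j [z [Jj Kz ->]]] := dec _ gx; exists j => // y Jy.
rewrite addrC addKr (lieC hbr) (disjoint_commute (@level_ideal_lie m) gK) ?oppr0 //.
  exact: level_ideal_subspace.
exact: level_ideal_sub.
Qed.

(** With [K] a complementary ideal, [[g m, g m]] is contained in [[J m, J m] + K]. The [K]-part of
    [c] lies in both [J m] and [K], so it is 0; hence [[J m, J m]] is an ideal containing the
    generator [c]. *)
Lemma level_ideal_perfect m : (k <= m)%N -> subset_of (J m) (derived br (J m)).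
Proof.
move=> km; have hJ := level_ideal_subspace m.
have Jg := level_ideal_sub km; have gJ := @level_ideal_lie m.
have hd : is_subspace (derived br (J m)) by exact: span_subspace.
have [K [hK Kg gK disj dec]] := g_red hJ Jg gJ.
have JK j z : J m j -> K z -> br j z = 0.
  exact: (disjoint_commute gJ gK hJ Jg Kg disj).
have KJ z j : K z -> J m j -> br z j = 0.
  by move=> Kz Jj; rewrite (lieC hbr) JK ?oppr0.
have [c1 [c2 [dc1 Kc2 cE]]] : exists c1 c2, [/\ derived br (J m) c1, K c2 & c = c1 + c2].
  have : derived br (g m) c by apply: (derived_mono (gmono km)) hc.
  move: (c); apply: span_sub; first exact: subspace_add.
  move=> _ [x [y [gx gy ->]]].
  have [j [z [Jj Kz ->]]] := dec _ gx; have [i [w [Ji Kw ->]]] := dec _ gy.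
  exists (br j i), (br z w); split; first by apply: mem_span; exists j, i.
    by apply: gK => //; exact: Kg.
  by rewrite (lieDl hbr) !(lieDr hbr) (JK j w) // (KJ z i) // addr0 add0r.
have dc : derived br (J m) c.
  suff c20 : c2 = 0 by rewrite cE c20 addr0.
  apply: disj => //; have -> : c2 = c - c1 by rewrite cE addrC addKr.
  apply: (subspaceB hJ); first exact: level_ideal_gen.
  by apply: derived_sub dc1; split=> // x y /Jg; exact: level_ideal_lie.
move=> v; apply=> // x y gx; move: y; apply: span_sub.
  split=> [|u w hu hw|a u hu]; rewrite ?(lie0r hbr) ?(lieDr hbr) ?(lieZr hbr).
  - exact: subspace0.
  - exact: subspaceD.
  - exact: subspaceZ.
move=> _ [u [w [Ju Jw ->]]]; rewrite (lie_jacobi hbr).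
apply: subspaceD => //; apply: mem_span.
  by exists (br x u), w; split=> //; exact: level_ideal_lie.
by exists u, (br x w); split=> //; exact: level_ideal_lie.
Qed.

(** Let [K] complement the centre in [g m]. Brackets in [J m] ignore central parts, so [J m], being
    perfect, lies in [K] and meets the centre in 0. *)
Lemma level_ideal_center m j : (k <= m)%N -> J m j ->
  (forall y, J m y -> br j y = 0) -> j = 0.
Proof.
move=> km Jj hj; have hJ := level_ideal_subspace m; have Jg := level_ideal_sub km.
pose Z j := J m j /\ forall y, J m y -> br j y = 0.
have hZ : is_subspace Z.
  split.
  - by split; [exact: (subspace0 hJ) | move=> y _; exact: lie0l].
  - move=> u v [Ju hu] [Jv hv]; split; first exact: (subspaceD hJ).
    by move=> y Jy; rewrite (lieDl hbr) hu // hv // addr0.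
  - move=> a u [Ju hu]; split; first exact: (subspaceZ _ hJ).
    by move=> y Jy; rewrite (lieZl hbr) hu // scaler0.
have gZ x z : g m x -> Z z -> Z (br x z).
  move=> gx [Jz hz]; split; first exact: level_ideal_lie.
  move=> y Jy; have := lie_jacobi hbr x z y.
  by rewrite hz // (hz (br x y)) ?(lie0r hbr) ?addr0 //; exact: level_ideal_lie.
have [|K [hK Kg gK disj dec]] := g_red hZ _ gZ; first by move=> v [/Jg].
have JK : subset_of (J m) K.
  move=> v /(level_ideal_perfect km); apply: span_sub => // _ [x [y [Jx Jy ->]]].
  have [z [w [Zz Kw yE]]] := dec _ (Jg _ Jy).
  rewrite yE (lieDr hbr) (lieC hbr x z) Zz.2 // oppr0 add0r.
  by apply: gK => //; exact: Jg.
by apply: disj; [split | exact: JK].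
Qed.

Definition ideal_union v := exists m, (k <= m)%N /\ J m v.
Local Notation S := ideal_union.

Lemma ideal_unionP : ideal br S.
Proof.
split; first split.
- by exists k; split=> //; exact: (subspace0 (level_ideal_subspace k)).
- move=> x y [m [km Jx]] [n [kn Jy]]; exists (maxn m n); split.
    exact: leq_trans km (leq_maxl _ _).
  apply: (subspaceD (level_ideal_subspace _)).
    exact: (level_ideal_mono (leq_maxl _ _)).
  exact: (level_ideal_mono (leq_maxr _ _)).
- move=> a x [m [km Jx]]; exists m; split=> //; exact: (subspaceZ _ (level_ideal_subspace _)).
move=> x y [n [kn Jy]]; have [m gx] := g_cover x.
exists (maxn m n); split; first exact: leq_trans kn (leq_maxr _ _).
apply: level_ideal_lie; first exact: (gmono (leq_maxl _ _)).
exact: (level_ideal_mono (leq_maxr _ _)).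
Qed.

Lemma ideal_union_derived : subset_of S (derived br (fun _ => True)).
Proof.
move=> v [m [_]]; apply; first exact: span_subspace.
  exact: derived_mono hc.
by move=> x y _ _; apply: mem_span; exists x, y.
Qed.

(** The elements of [J m] killing the image of [S] form an ideal [I] of [g m]. Two of them have both
    products zero, so they commute by faithfulness of [rho]; a complement of [I] commutes with [I]
    as well. So [a] is central in [J m], hence 0. *)
Lemma ideal_union_faithful a : S a ->
  (forall y v, S y -> rho a (rho y v) = 0) -> a = 0.
Proof.
move=> [m [km Ja]] ha; have hJ := level_ideal_subspace m; have Jg := level_ideal_sub km.
pose I a := J m a /\ forall y v, S y -> rho a (rho y v) = 0.
have hI : is_subspace I.
  split.
  - by split; [exact: (subspace0 hJ) | move=> y v _; rewrite rho0l].
  - move=> u w [Ju hu] [Jw hw]; split; first exact: (subspaceD hJ).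
    by move=> y v Sy; rewrite rhoDl hu // hw // addr0.
  - move=> b u [Ju hu]; split; first exact: (subspaceZ _ hJ).
    by move=> y v Sy; rewrite rhoZl hu // scaler0.
have gI x u : g m x -> I u -> I (br x u).
  move=> gx [Ju hu]; split; first exact: level_ideal_lie.
  move=> y v Sy; rewrite rho_br hu // rho0r sub0r.
  have -> : rho x (rho y v) = rho (br x y) v + rho y (rho x v).
    by rewrite rho_br subrK.
  rewrite rhoDr !hu ?addr0 ?oppr0 //.
  by case: ideal_unionP => _; apply.
have [|K [hK Kg gK disj dec]] := g_red hI _ gI; first by move=> v [/Jg].
apply: (level_ideal_center km Ja) => y Jy.
have [u [w [Iu Kw yE]]] := dec _ (Jg _ Jy).
have Ia : I a by [].
have -> : br a y = br a u + br a w by rewrite yE (lieDr hbr).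
have -> : br a w = 0.
  apply: (disjoint_commute gI gK hI _ Kg disj Ia Kw) => v [/Jg //].
rewrite addr0; apply: rho_faithful => v.
have Su : S u by case: Iu => Ju _; exists m.
have Sa : S a by exists m.
by rewrite rho_br (Ia.2 u) // (Iu.2 a) // subr0.
Qed.

(** * Elements acting trivially on the image of [c] *)

Definition action_space (X : L -> Prop) :=
  span (fun w => exists y v, X y /\ w = rho y v).
Local Notation JV m := (action_space (J m)).
Local Notation SV := (action_space S).

Lemma level_space_mono m n : (m <= n)%N -> subset_of (JV m) (JV n).
Proof.
move=> mn; apply: span_mono => _ [y [v [Jy ->]]]; exists y, v.
by split=> //; exact: (level_ideal_mono mn).
Qed.

Lemma rho_action_space (X : L -> Prop) x w : (forall y, X y -> X (br x y)) ->
  action_space X w -> action_space X (rho x w).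
Proof.
move=> hX; have hS : is_subspace (action_space X) by exact: span_subspace.
move: w; apply: span_sub.
  split=> [|u v hu hv|a u hu]; rewrite ?rho0r ?rhoDr ?rhoZr.
  - exact: subspace0.
  - exact: subspaceD.
  - exact: subspaceZ.
move=> _ [y [v [Xy ->]]].
have -> : rho x (rho y v) = rho (br x y) v + rho y (rho x v).
  by rewrite rho_br subrK.
apply: subspaceD => //; apply: mem_span.
  by exists (br x y), v; split=> //; exact: hX.
by exists y, (rho x v).
Qed.

Lemma rho_level_space m x w : g m x -> JV m w -> JV m (rho x w).
Proof.
by move=> gx; apply: rho_action_space => y; exact: level_ideal_lie.
Qed.

Lemma rho_total_space x w : SV w -> SV (rho x w).
Proof.
apply: rho_action_space => y Sy.
by case: ideal_unionP => _; apply.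
Qed.

(** Chosen to pass from level [m] to [m.+1]: the condition on [c] spreads to all of [J m], and with
    the last one it makes the product of two such operators vanish on [SV]. *)
Definition small_complement m z := [/\ g m z, forall y, J m y -> br z y = 0,
  forall v, rho z (rho c v) = 0 & forall w, SV w -> JV m (rho z w)].
Local Notation K0 := small_complement.

(** The [a] in [J m] with [rho z (rho a v) = 0] for all [v] form a subspace stable under [g m] and
    containing [c]. *)
Lemma small_complement_zero m z a v : (k <= m)%N -> K0 m z -> J m a ->
  rho z (rho a v) = 0 /\ rho a (rho z v) = 0.
Proof.
move=> km [gz zJ zc _] Ja; rewrite -(rho_commute v (zJ _ Ja)).
suff h : J m a /\ forall v, rho z (rho a v) = 0 by case: h => _ h; rewrite h.
have hJ := level_ideal_subspace m.
apply: (Ja (fun a => J m a /\ forall v, rho z (rho a v) = 0)).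
- split.
  + by split; [exact: (subspace0 hJ) | move=> u; rewrite rho0l rho0r].
  + move=> u w [Ju hu] [Jw hw]; split; first exact: (subspaceD hJ).
    by move=> x; rewrite rhoDl rhoDr hu hw addr0.
  + move=> b u [Ju hu]; split; first exact: (subspaceZ _ hJ).
    by move=> x; rewrite rhoZl rhoZr hu scaler0.
- by split=> //; exact: level_ideal_gen.
move=> x y gx [Jy hy]; split; first exact: level_ideal_lie.
move=> u; have [j Jj hj] := level_split km gx.
(* On [J m] the element [x] acts as [j], which commutes with [z] while [x] need not. *)
have -> : br x y = br j y by apply/eqP; rewrite -subr_eq0 -(lieBl hbr) hj.
by rewrite rho_br rhoBr (rho_commute _ (zJ _ Jj)) hy rho0r sub0r hy oppr0.
Qed.

Lemma small_complement_space m z w : (k <= m)%N -> K0 m z -> JV m w -> rho z w = 0.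
Proof.
move=> km Kz; apply: rho_kernel => _ [y [v [Jy ->]]].
by have [] := small_complement_zero v km Kz Jy.
Qed.

Lemma small_complement_sq m z z' w : (k <= m)%N -> K0 m z -> K0 m z' ->
  SV w -> rho z (rho z' w) = 0.
Proof.
move=> km Kz [_ _ _ z'S] Sw; exact: small_complement_space km Kz (z'S _ Sw).
Qed.

Lemma small_complement_lie m x z : (k <= m)%N -> g m x -> K0 m z -> K0 m (br x z).
Proof.
move=> km gx Kz; have [gz zJ zc zS] := Kz; split.
- exact: gle.
- move=> y Jy; have := lie_jacobi hbr x z y.
  rewrite zJ // (zJ (br x y)) ?(lie0r hbr) ?addr0 //; exact: level_ideal_lie.
- move=> v; rewrite rho_br zc rho0r sub0r.
  have -> : rho x (rho c v) = rho (br x c) v + rho c (rho x v).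
    by rewrite rho_br subrK.
  have [|h _] := small_complement_zero v km Kz (a := br x c).
    by apply: level_ideal_lie => //; exact: level_ideal_gen.
  by rewrite rhoDr h zc addr0 oppr0.
- move=> w Sw; rewrite rho_br; apply: (subspaceB (span_subspace _)).
    by apply: rho_level_space => //; exact: zS.
  by apply: zS; exact: rho_total_space.
Qed.

(* On [SV] a product of two elements of [K0 m] vanishes, and each term of the
   expanded triple commutator has two of them on the same side of [p]. *)
Lemma small_complement_cube m z1 z2 z3 p : (k <= m)%N ->
  K0 m z1 -> K0 m z2 -> K0 m z3 -> S p -> br z1 (br z2 (br z3 p)) = 0.
Proof.
move=> km K1 K2 K3 Sp; have [hS SS] := ideal_unionP.
apply: ideal_union_faithful; first exact: SS _ _ (SS _ _ (SS _ _ Sp)).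
move=> y v Sy; have : SV (rho y v) by apply: mem_span; exists y, v.
move: (rho y v) => w Sw.
have sq z z' u : K0 m z -> K0 m z' -> SV u -> rho z (rho z' u) = 0.
  exact: small_complement_sq.
rewrite !rho_br !rhoBr.
rewrite !(sq z1 z2) ?(sq z1 z3) ?(sq z2 z3) ?(sq z3 z2) ?(sq z3 z1) ?(sq z2 z1) //;
  try by do ?apply: rho_total_space.
by rewrite !rho0r !subr0.
Qed.

(** The part [P] of [J m.+1] centralized by [K0 m] is stable under [g m], so reductivity of [g m] in
    [g m.+1] gives it a stable complement. There no nonzero vector of [J m.+1] is killed by all of
    [K0 m], yet any three elements of [K0 m] applied in succession give 0; so [P] is all of
    [J m.+1]. *)
Lemma small_complement_next m z p : (k <= m)%N -> K0 m z -> J m.+1 p -> br z p = 0.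
Proof.
move=> km; have km1 : (k <= m.+1)%N by exact: leqW.
have hJ := level_ideal_subspace m.+1; have Jg := level_ideal_sub km1.
pose P p := J m.+1 p /\ forall z, K0 m z -> br z p = 0.
have hP : is_subspace P.
  split.
  - by split; [exact: (subspace0 hJ) | move=> y _; exact: lie0r].
  - move=> u v [Ju hu] [Jv hv]; split; first exact: (subspaceD hJ).
    by move=> y Ky; rewrite (lieDr hbr) hu // hv // addr0.
  - move=> a u [Ju hu]; split; first exact: (subspaceZ _ hJ).
    by move=> y Ky; rewrite (lieZr hbr) hu // scaler0.
have gP x u : g m x -> P u -> P (br x u).
  move=> gx [Ju hu]; split; first exact: (level_ideal_lie (g_succ gx)).
  move=> y Ky; rewrite (lie_jacobi hbr) (hu y Ky) (lie0r hbr) addr0.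
  rewrite (lieC hbr y x) (lieNl hbr) hu ?oppr0 //.
  exact: small_complement_lie.
have [|W [hW Wg gW disj dec]] := g_red_in hP _ gP; first by move=> v [/Jg].
pose Q q := J m.+1 q /\ W q.
have Q0 q : Q q -> (forall z, K0 m z -> br z q = 0) -> q = 0.
  by move=> [Jq Wq] hq; apply: disj.
have Qlie y q : K0 m y -> Q q -> Q (br y q).
  by move=> [gy _ _ _] [Jq Wq]; split; [exact: (level_ideal_lie (g_succ gy)) | exact: gW].
have Qzero q : Q q -> q = 0.
  move=> Qq; apply: (Q0 _ Qq) => z3 K3; have Q3 := Qlie _ _ K3 Qq.
  apply: (Q0 _ Q3) => z2 K2; have Q2 := Qlie _ _ K2 Q3.
  apply: (Q0 _ Q2) => z1 K1.
  by apply: (small_complement_cube km K1 K2 K3); exists m.+1; split=> //; case: Qq.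
move=> Kz Jp; have [u [w [Pu Ww pE]]] := dec _ (Jg _ Jp).
have w0 : w = 0.
  apply: Qzero; split=> //; have -> : w = p - u by rewrite pE addrC addKr.
  by apply: (subspaceB hJ) => //; case: Pu.
by rewrite pE w0 addr0; exact: Pu.2.
Qed.

(** [small_complement_next] supplies the one condition of [K0 m.+1] not evidently inherited from
    [K0 m], so [z] stays in [K0] at all higher levels. *)
Lemma small_complement_centralizes m z : (k <= m)%N -> K0 m z -> centralizes br S z.
Proof.
move=> km Kz y [n [kn Jy]].
suff [_ h _ _] : K0 (m + n) z by apply: h; exact: (level_ideal_mono (leq_addl _ _)).
elim: n {kn Jy} => [|n IH]; first by rewrite addn0.
have [gz zJ zc zS] := IH; rewrite addnS; split=> //.
- exact: g_succ.
- move=> p; apply: small_complement_next IH.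
  exact: leq_trans km (leq_addr _ _).
- by move=> w /zS; exact: (level_space_mono (leqnSn _)).
Qed.

(** The image of [SV] under [rho x] is finite-dimensional and lies in [SV], the increasing union of
    the [JV m]. *)
Lemma small_level x : exists m, forall w, SV w -> JV m (rho x w).
Proof.
have hSV : is_subspace SV by exact: span_subspace.
pose I w := exists2 v, SV v & w = rho x v.
have [s hs] := rho_fin x.
have hI : is_subspace I.
  split.
  - by exists 0; [exact: subspace0 | rewrite rho0r].
  - move=> _ _ [u Su ->] [v Sv ->]; exists (u + v); first exact: subspaceD.
    by rewrite rhoDr.
  - move=> a _ [u Su ->]; exists (a *: u); first exact: subspaceZ.
    by rewrite rhoZr.
have [|t ht] := fin_dim_sub (fin_dim_span s) hI; first by move=> _ [v _ ->].
have [||m hm] := @common_level _ (fun m => JV m) t.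
- by move=> i j ij w; exact: level_space_mono.
- move=> w wt; have [v Sv ->] := (ht w).2 (mem_span wt).
  move: {t ht hI w wt I} (rho x v) (rho_total_space x Sv).
  apply: span_sub.
    split.
    + by exists 0%N; exact: (subspace0 (span_subspace _)).
    + move=> u w [i hu] [j hw]; exists (maxn i j).
      apply: (subspaceD (span_subspace _)).
        exact: (level_space_mono (leq_maxl _ _)).
      exact: (level_space_mono (leq_maxr _ _)).
    + by move=> a u [i hu]; exists i; exact: (subspaceZ _ (span_subspace _)).
  move=> _ [y [u [[i [_ Jy]] ->]]]; exists i; apply: mem_span.
  by exists y, u.
exists m => w Sw; have /ht hw : I (rho x w) by exists w.
by move: hw; apply: span_sub; first exact: span_subspace.
Qed.

(* If [x = j + z] with [j] in [J m] and [z] centralizing [J m], then [z] maps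
   the image of [c] to itself; this bounds the number of independent outer
   actions on [S] by the square of the rank of [c]. *)
Lemma outer_action_bound : exists N, forall x : 'I_N -> L,
  exists a : 'I_N -> F, (exists i, a i != 0) /\
    exists u, S u /\ centralizes br S (\sum_i a i *: x i - u).
Proof.
pose I w := exists v, w = rho c v.
have hI : is_subspace I.
  split.
  - by exists 0; rewrite rho0r.
  - by move=> _ _ [u ->] [v ->]; exists (u + v); rewrite rhoDr.
  - by move=> a _ [u ->]; exists (a *: u); rewrite rhoZr.
have [s hs] := rho_fin c.
have [|t ht] := fin_dim_sub (fin_dim_span s) hI; first by move=> _ [v ->].
set n := size t; exists (n * n).+1 => x.
have [||m hm] := @common_level _ (fun m y => [/\ (k <= m)%N, g m y &
    forall w, SV w -> JV m (rho y w)]) (codom x).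
- move=> i j ij y [ki gy hy]; split; first exact: leq_trans ki ij.
    exact: (gmono ij).
  by move=> w /hy; exact: level_space_mono.
- move=> y _; have [i gy] := g_cover y; have [j hy] := small_level y.
  exists (maxn k (maxn i j)); split; first exact: leq_maxl.
    by apply: gmono gy; rewrite !leq_max leqnn orbT.
  by move=> w /hy; apply: level_space_mono; rewrite !leq_max leqnn !orbT.
have xm i : [/\ (k <= m)%N, g m (x i) & forall w, SV w -> JV m (rho (x i) w)].
  by apply: hm; exact: codom_f.
have km : (k <= m)%N by case: (xm ord0).
have split i : exists j, J m j /\ forall y, J m y -> br (x i - j) y = 0.
  by have [_ gx _] := xm i; have [j Jj hj] := level_split km gx; exists j.
have [j hj] := choice split.
pose z i := x i - j i.
have zI i (l : 'I_n) : exists b : 'I_n -> F, rho (z i) t`_l = \sum_r b r *: t`_r.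
  apply: span_coord; apply/ht.
  have [v ->] := (ht t`_l).2 (mem_span (mem_nth 0 (ltn_ord l))).
  exists (rho (z i) v); apply: rho_commute.
  by case: (hj i) => _; apply; exact: level_ideal_gen.
have zI' i : exists b : 'I_n -> 'I_n -> F, forall l : 'I_n,
    rho (z i) t`_l = \sum_r b l r *: t`_r.
  by have [b hb] := choice (zI i); exists b.
have [b hb] := choice zI'.
(* Row [i] lists the [n * n] coefficients of [z i] on the generators [t] of the image of [c], so
   [(n * n).+1] rows are dependent. If [t] is itself dependent, any choice of coefficients does: a
   vanishing combination of them still kills each generator. *)
pose A := \matrix_i mxvec (\matrix_(l, r) b i l r : 'M[F]_(n, n)).
have [a [a0 aA]] := @row_dependence F _ _ A (leqnn _).
exists a; split=> //.
pose zz := \sum_i a i *: z i.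
have zzE : \sum_i a i *: x i - \sum_i a i *: j i = zz.
  by rewrite -sumrB; apply: eq_bigr => i _; rewrite -scalerBr.
have hJ := level_ideal_subspace m.
exists (\sum_i a i *: j i); split.
  exists m; split=> //; apply: subspace_sum => // i _; apply: (subspaceZ _ hJ).
  by case: (hj i).
rewrite zzE; apply: (small_complement_centralizes km); split.
- apply: subspace_sum => // i _; apply: subspaceZ => //; apply: subspaceB => //.
    by case: (xm i).
  by apply: (level_ideal_sub km); case: (hj i).
- move=> y Jy; rewrite (lie_suml hbr) big1 // => i _.
  by rewrite (lieZl hbr); case: (hj i) => _ ->; rewrite ?scaler0.
- have hz (l : 'I_n) : rho zz t`_l = 0.
    rewrite rho_suml; under eq_bigr do rewrite rhoZl hb scaler_sumr.
    rewrite exchange_big /= big1 // => r _.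
    rewrite -[RHS](scale0r t`_r) -(aA (mxvec_index l r)) scaler_suml.
    by apply: eq_bigr => i _; rewrite mxE mxvecE mxE scalerA.
  move=> v; have /ht : I (rho c v) by exists v.
  apply: rho_kernel => w /(nthP 0)[l lt <-].
  exact: (hz (Ordinal lt)).
- move=> w Sw; have hJV : is_subspace (JV m) by exact: span_subspace.
  rewrite rho_suml; apply: subspace_sum => // i _; rewrite rhoZl rhoBl.
  apply: (subspaceZ _ hJV); apply: (subspaceB hJV); first by case: (xm i) => _ _; apply.
  by apply: mem_span; exists (j i), w; case: (hj i).
Qed.

End Structure.

(** * Borel subalgebras of the derived algebra *)

Lemma finitary_finite_rank (F : fieldType) (L V : lmodType F) (rho : L -> V -> V)
    (I : eqType) (e : I -> V) x :
  linear (rho x) ->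
  (forall v, exists (s : seq I) (c : I -> F), v = \sum_(i <- s) c i *: e i) ->
  (exists s : seq I, forall i, (i \notin s -> rho x (e i) = 0) /\
     exists c : I -> F, rho x (e i) = \sum_(j <- s) c j *: e j) ->
  exists s : seq V, forall v, span (fun w => w \in s) (rho x v).
Proof.
move=> rho_lin gen [s hs]; exists (map e s) => v.
have hS := span_subspace (fun w => w \in map e s).
have [t [d ->]] := gen v; elim/big_rec: _ => [|i u _ hu].
  by rewrite (linop0 rho_lin); exact: subspace0.
rewrite (linop_comb rho_lin); apply: subspaceD => //; apply: subspaceZ => //.
have [_ [c ->]] := hs i; apply: subspace_sum_seq => // j js.
by apply: subspaceZ => //; apply: mem_span; exact: map_f.
Qed.

Lemma derived_ideal (F : fieldType) (L : lmodType F) (br : L -> L -> L) :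
  ideal br (derived br (fun _ => True)).
Proof.
split; first exact: span_subspace.
by move=> x y _; apply: mem_span; exists x, y.
Qed.

Lemma derived_exhaustion (F : fieldType) (L : lmodType F)
    (br : L -> L -> L) (g : nat -> L -> Prop) c :
  (forall n, subset_of (g n) (g n.+1)) -> (forall x, exists n, g n x) ->
  derived br (fun _ => True) c -> exists k, derived br (g k) c.
Proof.
move=> g_succ g_cover; move: c.
apply: (@span_sub _ _ _ (fun c => exists k, derived br (g k) c)).
  split.
  - by exists 0%N; exact: (subspace0 (span_subspace _)).
  - move=> x y [i hx] [j hy]; exists (maxn i j).
    apply: (subspaceD (span_subspace _)).
      exact: (derived_mono (level_mono g_succ (leq_maxl _ _)) hx).
    exact: (derived_mono (level_mono g_succ (leq_maxr _ _)) hy).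
  - by move=> a x [i hx]; exists i; exact: (subspaceZ _ (span_subspace _)).
move=> _ [x [y [_ _ ->]]].
have [i gx] := g_cover x; have [j gy] := g_cover y; exists (maxn i j).
apply: mem_span; exists x, y; split=> //.
  exact: (level_mono g_succ (leq_maxl _ _)).
exact: (level_mono g_succ (leq_maxr _ _)).
Qed.

Theorem theorem7p1 (F : closedFieldType) (hF : [pchar F] =i pred0)
  (L : lmodType F) (br : L -> L -> L)
  (hbr : is_lie_bracket br) (hcount : countable_dim (fun _ : L => True))
  (hfin : finitary br) (hred : locally_reductive br)
  (b : L -> Prop) (hb : is_Borel br (fun _ => True) b) :
  is_Borel br (derived br (fun _ => True))
              (fun x => b x /\ derived br (fun _ => True) x).
Proof.
have char0 n : n.+1%:R != 0 :> F by have /pcharf0P -> := hF.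
have [g [g_alg [g_fin [g_red [g_succ [g_red_in g_cover]]]]]] := hred.
have [V [rho [I [e [rho_linl [rho_linr [rho_br [rho_faithful [_ [gen fin]]]]]]]]]] := hfin.
have rho_fin x := finitary_finite_rank (rho_linr x) gen (fin x).
have [ab _ lb _] := hb; have [hb0 bb] := ab.
have aD : is_subalgebra br (derived br (fun _ => True)).
  exact: ideal_subalgebra (derived_ideal br).
have abD := subalgebraI ab aD; split=> //.
- by move=> x [].
- by apply: locally_solvable_sub lb abD _ => x [].
move=> C aC CD lC bC c Cc; split; last exact: CD.
have [k ck] := derived_exhaustion g_succ g_cover (CD c Cc).
pose S := ideal_union br g c k.
have hS : ideal br S := ideal_unionP br g_succ g_cover c k.
have [hS0 SS] := hS; have [hC0 CC] := aC.
have SD : subset_of S (derived br (fun _ => True)) := ideal_union_derived ck.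
have aCS := subalgebraI aC (ideal_subalgebra hS).
(* The normalizer of [C /\ S] in [b]. *)
pose h y := b y /\ forall v, C v /\ S v -> C (br y v) /\ S (br y v).
have hh : is_subspace h.
  split.
  - split=> [|v _]; first exact: subspace0.
    by rewrite (lie0l hbr); split; exact: subspace0.
  - move=> x y [bx hx] [By hy]; split=> [|v Cv]; first exact: subspaceD.
    have [? ?] := hx v Cv; have [? ?] := hy v Cv.
    by rewrite (lieDl hbr); split; exact: subspaceD.
  - move=> a x [bx hx]; split=> [|v Cv]; first exact: subspaceZ.
    by have [? ?] := hx v Cv; rewrite (lieZl hbr); split; exact: subspaceZ.
have [N hN] := outer_action_bound hbr g_alg g_succ g_cover g_red g_red_in
  rho_linl rho_linr rho_br rho_faithful rho_fin ck.
have [|xs [xsb hxs]] := finite_codim (N := N) hh hb0.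
  move=> x bx; have [a [a0 [u [Su xu]]]] := hN x; exists a; split=> //.
  have bxa : b (\sum_i a i *: x i).
    by apply: subspace_sum => // i _; exact: subspaceZ.
  (* The combination acts on [S] as [u], and [u] lies in [b /\ [g, g]], hence in [C]; so the
     combination normalizes [C /\ S]. *)
  have bu : b u := borel_inner hbr g_alg g_fin g_succ g_cover hb hS bxa Su xu.
  have Cu : C u by apply: bC; split=> //; exact: SD.
  split=> // v [Cv Sv].
  have -> : br (\sum_i a i *: x i) v = br u v.
    by apply/eqP; rewrite -subr_eq0 -(lieBl hbr) xu.
  by split; [exact: CC | exact: SS].
apply: (stable_extension char0 hbr g_alg g_fin g_succ g_cover hb hS hh _ _ xsb hxs aCS).
- by move=> x [].
(* [[b, b]] lies in [b /\ [g, g]], hence in [C], so it normalizes [C /\ S]. *)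
- move=> x y bx By; split; first exact: bb.
  move=> v [Cv Sv]; split; last exact: SS.
  apply: CC => //; apply: bC; split; first exact: bb.
  by apply: mem_span; exists x, y.
- by move=> v [].
- by apply: locally_solvable_sub lC aCS _ => v [].
- by move=> u bu Su; split=> //; apply: bC; split=> //; exact: SD.
- by move=> y v [_ hy]; exact: hy.
- by split=> //; exists k; split=> //; exact: level_ideal_gen.
Qed.
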